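(* Let $a>0$. There are no complete spacelike hypersurfaces of non-positive constant mean curvature bounded away from future infinity in the $(m+1)$-dimensional Robertson-Walker radiation model $\mathbb{R}^+\times_{(2at)^{1/2}}\mathbb{R}^m$.
   Context: Here $m\ge 2$, $\mathbb{R}^+=(0,+\infty)$, and $\mathbb{R}^+\times_{(2at)^{1/2}}\mathbb{R}^m$ is $\overline{M}=\mathbb{R}^+\times\mathbb{R}^m$ with the Lorentzian metric $\overline{g}=-dt^2+2at\,g_0$, where $g_0$ is the Euclidean metric on $\mathbb{R}^m$ (warped product with warping function $\rho(t)=(2at)^{1/2}$), time-oriented by $\partial_t$. A spacelike hypersurface is an immersion $\psi:M\to\overline{M}$ of an $m$-dimensional manifold $M$ such that the induced metric $g$ on $M$ is Riemannian; it is complete if $(M,g)$ is complete. Let $N$ be the unique globally defined unit timelike normal field along $\psi$ with $\overline{g}(N,\partial_t)\le -1$; the shape operator is $AX=-\overline{\nabla}_XN$, with $\overline{\nabla}$ the Levi-Civita connection of $\overline{g}$, and the mean curvature is $H=-\frac1m\mathrm{trace}(A)$ (so a slice $\{t_0\}\times\mathbb{R}^m$ has $H=\rho'(t_0)/\rho(t_0)$). Let $\tau:M\to\mathbb{R}^+$ be the composition of $\psi$ with the projection onto $\mathbb{R}^+$. The hypersurface is bounded away from future infinity if $\sup_M\tau<+\infty$. *)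

(* Defs.v *)
From HB Require Import structures.
From mathcomp Require Import all_boot all_order all_algebra.
From mathcomp Require Import all_classical all_reals all_analysis.

Set Implicit Arguments.
Unset Strict Implicit.
Unset Printing Implicit Defensive.

Import Order.TTheory GRing.Theory Num.Theory.
Import numFieldNormedType.Exports.

Local Open Scope classical_set_scope.
Local Open Scope ring_scope.

(** * Smooth maps and smooth manifolds *)

(* [Ck_on k U f]: the map [f] is of class C^k on the open set [U]. *)
Fixpoint Ck_on (R : realType) (V W : normedModType R) (k : nat) (U : set V)
    (f : V -> W) : Prop :=
  match k with
  | 0 => {in U, continuous f}
  | k'.+1 => {in U, forall x, differentiable f x} /\
             forall v, Ck_on k' U ('D_v f)
  end.

Definition smooth_on (R : realType) (V W : normedModType R) (U : set V)
    (f : V -> W) : Prop := forall k, Ck_on k U f.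

(* A chart is a homeomorphism [cmap] from the open set [cdom] of [M] onto an
   open set of R^m. Both [cmap] and its inverse [cinv] are total functions,
   meaningful only on [cdom] and on [cmap @` cdom] respectively. *)
Record chart (R : realType) (m : nat) (M : topologicalType) := Chart {
  cdom : set M ;
  cmap : M -> 'rV[R]_m ;
  cinv : 'rV[R]_m -> M ;
  cdom_open : open cdom ;
  cimg_open : open (cmap @` cdom) ;
  cmapK : {in cdom, cancel cmap cinv} ;
  cmap_continuous : {in cdom, continuous cmap} ;
  cinv_continuous : {in cmap @` cdom, continuous cinv} }.

Definition cimg (R : realType) (m : nat) (M : topologicalType)
    (c : chart R m M) : set 'rV[R]_m := cmap c @` cdom c.

Definition smooth_atlas (R : realType) (m : nat) (M : topologicalType)
    (A : set (chart R m M)) : Prop :=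
  \bigcup_(c in A) cdom c = [set: M] /\
  forall c c', A c -> A c' ->
    smooth_on (cmap c @` (cdom c `&` cdom c')) (cmap c' \o cinv c).

(* A (Hausdorff, second countable, non-empty, not necessarily connected)
   smooth manifold of dimension [m] with smooth structure given by [A]. *)
Definition smooth_manifold (R : realType) (m : nat) (M : topologicalType)
    (A : set (chart R m M)) : Prop :=
  [/\ [set: M] !=set0, hausdorff_space M, @second_countable M
    & smooth_atlas A].

Definition smooth_map (R : realType) (m n : nat) (M : topologicalType)
    (A : set (chart R m M)) (f : M -> 'rV[R]_n) : Prop :=
  forall c, A c -> smooth_on (cimg c) (f \o cinv c).

(** * Semi-Riemannian metrics on open subsets of R^n *)

(* A metric is given by its Gram matrix [G y] in the canonical frame; tangent
   vectors at [y] are row vectors. *)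
Definition metric (R : realType) (n : nat) : Type := 'rV[R]_n -> 'M[R]_n.

Definition inner (R : realType) (n : nat) (G : metric R n) (y u v : 'rV[R]_n)
    : R := (u *m G y *m v^T) 0 0.

Definition partial (R : realType) (n : nat) (i : 'I_n) (f : 'rV[R]_n -> R)
    : 'rV[R]_n -> R := 'D_(delta_mx 0 i) f.

(* Levi-Civita connection of [G]: [christoffel G y k i j] is the k-th component
   at [y] of the covariant derivative along the i-th coordinate vector field of
   the j-th one. *)
Definition christoffel (R : realType) (n : nat) (G : metric R n)
    (y : 'rV[R]_n) (k i j : 'I_n) : R :=
  2^-1 * \sum_l invmx (G y) k l *
    (partial i (fun z => G z j l) y + partial j (fun z => G z i l) y
     - partial l (fun z => G z i j) y).

(* Covariant derivative of a vector field [X] along a map [f] defined on an open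
   subset of R^m: row [j] is the derivative in the j-th coordinate direction. *)
Definition cov_along (R : realType) (m n : nat) (G : metric R n)
    (f X : 'rV[R]_m -> 'rV[R]_n) (x : 'rV[R]_m) : 'M[R]_(m, n) :=
  \matrix_(j, k) ('J X x j k +
    \sum_i \sum_l christoffel G (f x) k i l * 'J f x j i * X x 0 l).

(** * Robertson-Walker spacetimes with flat fibre *)

(* R^+ x R^m is realized in R^{m+1}, with [y 0 0] as the time coordinate. *)
Definition rw_space (R : realType) (m : nat) : set 'rV[R]_m.+1 :=
  [set y | 0 < y 0 0].

Definition rw_metric (R : realType) (m : nat) (rho : R -> R)
    : metric R m.+1 :=
  fun y => diag_mx (\row_i (if i == 0 then -1 else rho (y 0 0) ^+ 2)).

Definition dt (R : realType) (m : nat) : 'rV[R]_m.+1 := delta_mx 0 0.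

Definition radiation_warping (R : realType) (a : R) : R -> R :=
  fun t => Num.sqrt (2 * a * t).

(** * Spacelike hypersurfaces *)

Definition induced_metric (R : realType) (m n : nat) (M : topologicalType)
    (G : metric R n) (psi : M -> 'rV[R]_n) (c : chart R m M) : metric R m :=
  fun x => let J := 'J (psi \o cinv c) x in
           J *m G (psi (cinv c x)) *m J^T.

Definition riemannian_on (R : realType) (m : nat) (U : set 'rV[R]_m)
    (g : metric R m) : Prop :=
  forall x, U x -> forall v : 'rV[R]_m, v != 0 -> 0 < inner g x v v.

Definition immersion (R : realType) (m n : nat) (M : topologicalType)
    (A : set (chart R m M)) (psi : M -> 'rV[R]_n) : Prop :=
  smooth_map A psi /\
  forall c x, A c -> cimg c x -> row_free ('J (psi \o cinv c) x).

Definition spacelike_hypersurface (R : realType) (m : nat)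
    (M : topologicalType) (A : set (chart R m M)) (G : metric R m.+1)
    (psi : M -> 'rV[R]_m.+1) : Prop :=
  [/\ forall p, rw_space (psi p),
      immersion A psi
    & forall c, A c -> riemannian_on (cimg c) (induced_metric G psi c)].

Definition C1_curve_on (R : realType) (m : nat) (M : topologicalType)
    (A : set (chart R m M)) (s t : R) (gamma : R -> M) : Prop :=
  exists U : set R, [/\ open U, `[s, t] `<=` U, {in U, continuous gamma}
    & forall c, A c -> Ck_on 1 (U `&` gamma @^-1` cdom c) (cmap c \o gamma)].

Definition piecewise_C1_curve (R : realType) (m : nat) (M : topologicalType)
    (A : set (chart R m M)) (gamma : R -> M) : Prop :=
  exists (n : nat) (t : nat -> R),
    [/\ t 0%N = 0, t n = 1
      & forall k, (k < n)%N -> t k < t k.+1 /\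
          exists2 gammak, C1_curve_on A (t k) (t k.+1) gammak
                        & {in `[t k, t k.+1], gamma =1 gammak}].

(* For the metric induced by [psi], the speed of [gamma] is the length of the
   velocity vector of [psi \o gamma]. *)
Definition curve_length (R : realType) (n : nat) (M : topologicalType)
    (G : metric R n) (psi : M -> 'rV[R]_n) (gamma : R -> M) : \bar R :=
  (\int[lebesgue_measure]_(t in `[0%R, 1%R])
    (Num.sqrt (inner G (psi (gamma t)) ('D_1 (psi \o gamma) t)
                                       ('D_1 (psi \o gamma) t)))%:E)%E.

(* Equal to +oo when no curve joins [p] to [q]. *)
Definition riemannian_distance (R : realType) (m n : nat)
    (M : topologicalType) (A : set (chart R m M)) (G : metric R n)
    (psi : M -> 'rV[R]_n) (p q : M) : \bar R :=
  ereal_inf [set l | exists gamma : R -> M,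
    [/\ piecewise_C1_curve A gamma, gamma 0 = p, gamma 1 = q
      & l = curve_length G psi gamma]].

(* Completeness of [M] for the Riemannian distance of the induced metric. That
   distance induces the topology of [M], in which convergence is expressed. *)
Definition complete_hypersurface (R : realType) (m n : nat)
    (M : topologicalType) (A : set (chart R m M)) (G : metric R n)
    (psi : M -> 'rV[R]_n) : Prop :=
  forall u : nat -> M,
    (forall e : R, 0 < e -> exists K : nat, forall i j,
       (K <= i)%N -> (K <= j)%N ->
       (riemannian_distance A G psi (u i) (u j) < e%:E)%E) ->
    exists p : M, u @ \oo --> p.

(* [N] is the unit timelike normal field in the time orientation of [dt]. *)
Definition future_unit_normal (R : realType) (m : nat) (M : topologicalType)
    (A : set (chart R m M)) (G : metric R m.+1)
    (psi N : M -> 'rV[R]_m.+1) : Prop :=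
  [/\ smooth_map A N,
      forall p, inner G (psi p) (N p) (N p) = -1,
      forall c x, A c -> cimg c x -> forall v : 'rV[R]_m,
        inner G (psi (cinv c x)) (N (cinv c x))
              (v *m 'J (psi \o cinv c) x) = 0
    & forall p, inner G (psi p) (N p) (dt R m) <= -1].

(* Matrix of the shape operator in a chart: row [j] is made of the coordinates,
   in the coordinate basis of the tangent space, of the image of the j-th
   coordinate vector. The covariant derivative of [N] is tangent, so that this
   matrix [S] is the unique solution of
   [S *m 'J (psi \o cinv c) x = - cov_along G (psi \o cinv c) (N \o cinv c) x]
   when [psi] is an immersion. *)
Definition shape_operator (R : realType) (m n : nat) (M : topologicalType)
    (G : metric R n) (psi N : M -> 'rV[R]_n) (c : chart R m M)
    (x : 'rV[R]_m) : 'M[R]_m :=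
  - cov_along G (psi \o cinv c) (N \o cinv c) x
    *m pinvmx ('J (psi \o cinv c) x).

Definition mean_curvature (R : realType) (m n : nat) (M : topologicalType)
    (G : metric R n) (psi N : M -> 'rV[R]_n) (c : chart R m M)
    (x : 'rV[R]_m) : R := - (m%:R^-1 * \tr (shape_operator G psi N c x)).

Definition constant_mean_curvature (R : realType) (m n : nat)
    (M : topologicalType) (A : set (chart R m M)) (G : metric R n)
    (psi N : M -> 'rV[R]_n) (H : R) : Prop :=
  forall c x, A c -> cimg c x -> mean_curvature G psi N c x = H.

Definition bounded_away_from_future_infinity (R : realType) (m : nat)
    (M : topologicalType) (psi : M -> 'rV[R]_m.+1) : Prop :=
  (ereal_sup [set (psi p 0 0)%:E | p in [set: M]] < +oo)%E.

(* Main.v *)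
(** The projection of a spacelike hypersurface to R^m is a local diffeomorphism,
    and the lift of a segment is at most (2 a sup tau)^(1/2) times as long as the
    segment. By completeness radial segments can be lifted indefinitely, so the
    projection has a global continuous section: the hypersurface contains an
    entire graph over R^m. On this graph the function
    a |x|^2 / 2 + b (2 a t)^(1/2) - t, with b large, is coercive, hence attains a
    minimum, which is a local minimum on the hypersurface. There the second
    derivative test, traced with the induced metric, contradicts H <= 0. *)

Require Import Defs.
From HB Require Import structures.
From mathcomp Require Import all_boot all_order all_algebra.
From mathcomp Require Import all_classical all_reals all_analysis.
From mathcomp Require Import ring lra.
Import Order.TTheory GRing.Theory Num.Theory.
Import numFieldNormedType.Exports.
Set Implicit Arguments.
Unset Strict Implicit.
Unset Printing Implicit Defensive.
Local Open Scope classical_set_scope.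
Local Open Scope ring_scope.

(** * Positive definite matrices *)

(** On a complete non-compact hypersurface a function bounded below need not attain its infimum. The
    global section supplies the missing compactness: over R^m the barrier grows at least like a
    |x|^2 / 2, because - t stays above - sup tau. A single section suffices, so covering theory is
    avoided: a section is locally inverse to the projection, which turns a minimum along it into a
    local minimum on the hypersurface. The size of b comes from sigma = a / (2 a t)^(1/2), the
    derivative of the warping function. At a critical point b sigma > 1 fixes the sign of the normal
    derivative of the barrier, and b sigma > 2 makes the coefficient (2 - b sigma) / (2 t) of its
    ambient Hessian on the tangent space negative. The bound on tau lets one b serve at all
    points. *)

Lemma exists_congruent_identity (R : rcfType) (n : nat) (g : 'M[R]_n) :
  g^T = g -> (forall v : 'rV[R]_n, v != 0 -> 0 < (v *m g *m v^T) 0 0) ->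
  exists P : 'M[R]_n, P *m g *m P^T = 1%:M.
Proof.
elim: n g => [|n IH] g gsym gpos.
  by exists 0; apply/matrixP => -[].
move: g gsym gpos; rewrite -[n.+1]/(1 + n)%N => g gsym gpos.
set al := ulsubmx g; set v := ursubmx g; set h := drsubmx g.
have dl : dlsubmx g = v^T by rewrite /v trmx_ursub gsym.
have hsym : h^T = h by rewrite /h trmx_drsub gsym.
have gE : g = block_mx al v v^T h by rewrite -dl submxK.
have alE : al = (al 0 0)%:M by exact: mx11_scalar.
set A := al 0 0 in alE.
have A0 : 0 < A.
  have := gpos (row_mx 1%:M 0).
  rewrite -[X in X != _]/(row_mx _ _) gE mul_row_block tr_row_mx mul_row_col.
  rewrite !mul0mx !addr0 trmx0 mulmx0 addr0 trmx1 mulmx1 mul1mx; apply.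
  apply/eqP => /(congr1 lsubmx); rewrite row_mxKl linear0 => /matrixP/(_ 0 0).
  by rewrite !mxE/= => /eqP; rewrite oner_eq0.
(* Block elimination: [w] clears the off-diagonal blocks and leaves the Schur complement [h'], whose
   form at [u] is that of [g] at the row [(u w, u)]; so [h'] is again positive definite. *)
pose w : 'cV[R]_n := - (A^-1 *: v^T).
have wA : w *m al = - v^T.
  by rewrite alE mul_mx_scalar /w scalerN scalerA divff ?gt_eqF// scale1r.
pose h' := h + w *m v.
have Aw : al *m w^T = - v.
  rewrite alE mul_scalar_mx /w linearN/= linearZ/= trmxK scalerN scalerA.
  by rewrite divff ?gt_eqF// scale1r.
have hw : v^T *m w^T = w *m v.
  rewrite /w linearN/= linearZ/= trmxK mulmxN mulNmx -scalemxAr -scalemxAl.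
  by [].
have h'sym : h'^T = h' by rewrite /h' linearD/= trmx_mul hsym hw.
have h'pos (u : 'rV[R]_n) : u != 0 -> 0 < (u *m h' *m u^T) 0 0.
  move=> u0; have := gpos (row_mx (u *m w) u).
  have e1 : u *m w *m al + u *m v^T = 0 by rewrite -mulmxA wA -mulmxDr addNr mulmx0.
  have e2 : u *m w *m v + u *m h = u *m h' by rewrite -mulmxA -mulmxDr addrC.
  rewrite gE mul_row_block e1 e2 tr_row_mx mul_row_col mul0mx add0r; apply.
  apply: contraNN u0 => /eqP/(congr1 rsubmx).
  by rewrite row_mxKr linear0 => ->.
have [P' P'E] := IH h' h'sym h'pos.
pose L : 'M[R]_(1 + n) := block_mx 1%:M 0 w 1%:M.
pose D : 'M[R]_(1 + n) := block_mx (Num.sqrt A)^-1%:M 0 0 P'.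
exists (D *m L).
rewrite trmx_mul !mulmxA -(mulmxA D) -(mulmxA D).
have -> : L *m g *m L^T = block_mx al 0 0 h'.
  rewrite gE /L tr_block_mx !trmx1 trmx0 mulmx_block !mul1mx !mul0mx !addr0.
  rewrite wA addNr [_ + h]addrC -/h' mulmx_block !mulmx1 !mulmx0 !mul0mx !addr0.
  by rewrite add0r Aw addNr.
rewrite /D tr_block_mx trmx0 !mulmx_block !mulmx0 !mul0mx !addr0 !add0r P'E.
rewrite tr_scalar_mx alE -!scalar_mxM !(trmx0, mul0mx, mulmx0, addr0, add0r).
rewrite [X in X%:M](_ : _ = 1) ?scalar_mx_block// mulrAC -invfM -expr2.
by rewrite sqr_sqrtr ?ltW// mulVf// gt_eqF.
Qed.

(** The rows of a [P] with [P g P^T = 1] form a [g]-orthonormal basis, and the trace of [B] is the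
    sum over this basis of the values [v B g v^T]. *)
Lemma mxtrace_ge0_of_form (R : rcfType) (n : nat) (g B : 'M[R]_n) :
  g^T = g -> (forall v : 'rV[R]_n, v != 0 -> 0 < (v *m g *m v^T) 0 0) ->
  (forall v : 'rV[R]_n, 0 <= (v *m B *m g *m v^T) 0 0) -> 0 <= \tr B.
Proof.
move=> gsym gpos Bge0; have [P PgP] := exists_congruent_identity gsym gpos.
have -> : \tr B = \tr (P *m B *m g *m P^T).
  have gPP : g *m P^T *m P = 1%:M by apply: mulmx1C; rewrite mulmxA.
  by rewrite -!mulmxA mxtrace_mulC -!mulmxA [g *m _]mulmxA gPP mulmx1.
apply: sumr_ge0 => i _.
suff -> : (P *m B *m g *m P^T) i i = (row i P *m B *m g *m (row i P)^T) 0 0.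
  exact: Bge0.
by rewrite -!row_mul !mxE; apply: eq_bigr => j _; rewrite !mxE.
Qed.

(** * Calculus along a line *)

Lemma is_derive_line (R : realType) (V W : normedModType R) (f : V -> W)
    (x v : V) (s : R) :
  differentiable f (x + s *: v) ->
  is_derive s 1 (fun r : R => f (x + r *: v)) ('D_v f (x + s *: v)).
Proof.
move=> df.
have dl : is_diff s (fun r : R => x + r *: v) ( *:%R^~ v).
  by have := is_diffD (is_diff_cst x s) (is_diff_scalel s v); rewrite add0r.
have df' : is_diff (x + s *: v) f ('d f (x + s *: v)) by exact: DiffDef.
have dc : is_diff s (fun r : R => f (x + r *: v))
    ('d f (x + s *: v) \o *:%R^~ v).
  exact: (@is_diff_comp _ _ _ _ (fun r : R => x + r *: v) _ f _ s).
apply: DeriveDef.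
  by apply/derivable1_diffP; exact: (@ex_diff _ _ _ _ _ _ _ dc).
rewrite deriveE; last by case: dc.
by rewrite diff_val /= scale1r -deriveE.
Qed.

(** Were [h2] negative, [h1] would be negative just to the right of 0, and the mean value theorem
    would give some [h c < h 0] there. *)
Lemma local_min_derivative_test (R : realType) (h h1 : R -> R) (h2 : R) :
  (\forall s \near 0, is_derive (s : R) 1 h (h1 s)) ->
  is_derive (0 : R) 1 h1 h2 ->
  (\forall s \near 0, h 0 <= h s) -> h1 0 = 0 /\ 0 <= h2.
Proof.
move=> dh dh1 hmin.
have [e /= e0 he] : \forall s \near 0,
    is_derive (s : R) 1 h (h1 s) /\ h 0 <= h s by near do split.
have eB t : t \in `]- e, e[%R -> ball 0 e t.
  by rewrite in_itv/= /ball/= sub0r normrN ltr_norml.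
have h10 : h1 0 = 0.
  have m : is_derive (0:R) 1 h 0.
    apply: (@derive1_at_min _ h (- e) e).
    - by rewrite (@le_trans _ _ 0)// ?oppr_le0 ltW.
    - by move=> t /eB/he [[]].
    - by rewrite in_itv/= oppr_lt0 e0.
    - by move=> t /eB/he [].
  have [+ _] := he 0 (ballxx _ e0).
  by case=> _ <-; case: m => _ ->.
split => //; rewrite leNgt; apply/negP => h2lt0.
have [d /= d0 hd] : \forall s \near (0:R)^', s^-1 * (h1 s) < 0.
  have /cvgr_lt/(_ _ h2lt0) : s^-1 *: (h1 (s *: 1 + 0) - h1 0) @[s --> (0:R)^'] --> h2.
    have [dv <-] := dh1; exact: dv.
  rewrite h10; apply: filterS => s.
  by rewrite subr0 addr0 [_ *: 1]mulr1.
pose c := Num.min d e / 2.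
have c0 : 0 < c by rewrite divr_gt0// lt_min d0 e0.
have cm : c < Num.min d e by rewrite ltr_pdivrMr// ltr_pMr ?ltr1n// lt_min d0 e0.
have ce t : t \in `[0, c]%R -> ball 0 e t.
  rewrite in_itv/= => /andP[t0 tc]; apply: eB; rewrite in_itv/=.
  rewrite (lt_le_trans _ t0) ?oppr_lt0// (le_lt_trans tc)//.
  by rewrite (lt_le_trans cm)// ge_min lexx orbT.
have [z] : exists2 z, z \in `]0, c[%R & h c - h 0 = h1 z * (c - 0).
  apply: MVT => //.
    by move=> t /subset_itv_oo_cc /ce/he[].
  apply: derivable_within_continuous => t /ce/he[] hh _.
  exact: (@ex_derive _ _ _ _ _ _ _ hh).
rewrite in_itv/= subr0 => /andP[z0 zc] zE.
have : h1 z < 0.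
  have := hd z; rewrite /ball_/= sub0r normrN gtr0_norm//.
  rewrite (lt_trans zc) ?(lt_le_trans cm) ?ge_min ?lexx// => /(_ isT).
  by rewrite gt_eqF// => /(_ isT); rewrite pmulr_rlt0 ?invr_gt0.
move=> h1z; have : h1 z * c < 0 by rewrite pmulr_llt0.
rewrite -zE subr_lt0 ltNge => /negP; apply.
have cc : c \in `[0, c]%R by rewrite in_itv/= lexx ltW.
by have [] := he c (ce c cc).
Unshelve. all: by end_near. Qed.

Lemma is_derive_sumE (R : realType) (n : nat) (h : 'I_n -> R -> R) (s : R)
    (d : 'I_n -> R) :
  (forall i, is_derive s 1 (h i) (d i)) ->
  is_derive s 1 (fun r => \sum_i h i r) (\sum_i d i).
Proof.
move=> H; have := @is_derive_sum _ _ _ n h s 1 d H.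
suff -> : \sum_(i < n) h i = (fun r => \sum_i h i r) by [].
by apply/funext => r; rewrite fct_sumE.
Qed.

Section PointwiseRules.
Variables (R : realType) (s : R).
Implicit Types f g : R -> R.

Lemma is_derive_add f g df dg : is_derive s 1 f df -> is_derive s 1 g dg ->
  is_derive s 1 (fun r => f r + g r) (df + dg).
Proof. exact: is_deriveD. Qed.

Lemma is_derive_sub f g df dg : is_derive s 1 f df -> is_derive s 1 g dg ->
  is_derive s 1 (fun r => f r - g r) (df - dg).
Proof. exact: is_deriveB. Qed.

Lemma is_derive_mul f g df dg : is_derive s 1 f df -> is_derive s 1 g dg ->
  is_derive s 1 (fun r => f r * g r) (f s * dg + g s * df).
Proof. exact: is_deriveM. Qed.

Lemma is_derive_scale c f df : is_derive s 1 f df ->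
  is_derive s 1 (fun r => c * f r) (c * df).
Proof. exact: is_deriveZ. Qed.

Lemma is_derive_inv f df : f s != 0 -> is_derive s 1 f df ->
  is_derive s 1 (fun r => (f r)^-1) (- df / f s ^+ 2).
Proof.
move=> f0 dff; apply: is_derive_eq (is_deriveV f0 dff) _.
by rewrite -[RHS]mulrC mulrN -mulNr.
Qed.

End PointwiseRules.

(** Since [rho ^+ 2 = 2 a T], the derivative of [rho] in [T] is [a / rho], and differentiating this
    quotient once more yields the term in [T1 0 ^+ 2]. *)
Lemma radiation_second_variation (R : realType) (m : nat) (a b : R)
    (T T1 : R -> R) (T2 : R) (X X1 : 'I_m -> R -> R) (X2 : 'I_m -> R) :
  0 < a ->
  (\forall s \near 0, [/\ 0 < T s, is_derive (s : R) 1 T (T1 s)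
     & forall i, is_derive (s : R) 1 (X i) (X1 i s)]) ->
  is_derive (0 : R) 1 T1 T2 -> (forall i, is_derive (0 : R) 1 (X1 i) (X2 i)) ->
  let h s := a * 2^-1 * \sum_i X i s ^+ 2 + b * Num.sqrt (2 * a * T s) - T s in
  (\forall s \near 0, h 0 <= h s) ->
  let s := a / Num.sqrt (2 * a * T 0) in
  (b * s - 1) * T1 0 + a * \sum_i X i 0 * X1 i 0 = 0 /\
  0 <= - b * s / (2 * T 0) * T1 0 ^+ 2 + (b * s - 1) * T2
       + a * \sum_i X1 i 0 ^+ 2 + a * \sum_i X i 0 * X2 i.
Proof.
move=> a0 dTX dT1 dX1 h hmin s.
pose rho r := Num.sqrt (2 * a * T r).
pose h1 r := a * (\sum_i X i r * X1 i r) + (b * (a / rho r) - 1) * T1 r.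
have T0 : 0 < T 0 by case: (nbhs_singleton dTX).
have drho r : 0 < T r -> is_derive r 1 T (T1 r) ->
    is_derive r 1 rho (a / rho r * T1 r).
  move=> Tr dT.
  have p0 : 0 < 2 * a * T r by rewrite !mulr_gt0.
  apply: is_derive_eq (@is_derive1_comp _ _ _ r _ _ (is_derive1_sqrt p0)
    (is_derive_scale (2 * a) dT)) _.
  by rewrite /rho; field; rewrite gt_eqF// sqrtr_gt0.
have rho0 r : 0 < T r -> rho r != 0.
  by move=> Tr; rewrite gt_eqF// sqrtr_gt0 !mulr_gt0.
have dh : \forall r \near 0, is_derive (r : R) 1 h (h1 r).
  apply: filterS dTX => r [Tr dT dX].
  have dS : is_derive r 1 (fun q => \sum_i X i q ^+ 2)
      (\sum_i 2 * (X i r * X1 i r)).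
    apply: is_derive_sumE => i.
    rewrite (_ : (fun q => _) = fun q => X i q * X i q); last exact/funext.
    by apply: is_derive_eq (is_derive_mul (dX i) (dX i)) _; ring.
  apply: is_derive_eq (is_derive_sub (is_derive_add
    (is_derive_scale (a * 2^-1) dS) (is_derive_scale b (drho r Tr dT))) dT) _.
  by rewrite /h1 -mulr_sumr; field; exact: rho0.
have dh1 : is_derive (0 : R) 1 h1 (- b * s / (2 * T 0) * T1 0 ^+ 2
   + (b * s - 1) * T2 + a * \sum_i X1 i 0 ^+ 2 + a * \sum_i X i 0 * X2 i).
  have [dT dX] : is_derive (0:R) 1 T (T1 0) /\
    forall i, is_derive (0:R) 1 (X i) (X1 i 0).
    by case: (nbhs_singleton dTX).
  have dS : is_derive (0:R) 1 (fun q => \sum_i X i q * X1 i q)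
      (\sum_i (X i 0 * X2 i + X1 i 0 ^+ 2)).
    by apply: is_derive_sumE => i; exact: is_derive_mul (dX i) (dX1 i).
  have r0 := rho0 0 T0.
  have rr : rho 0 ^+ 2 = 2 * a * T 0 by rewrite sqr_sqrtr// !mulr_ge0// ltW.
  have dV := is_derive_inv r0 (drho 0 T0 dT).
  apply: is_derive_eq (is_derive_add (is_derive_scale a dS)
    (is_derive_mul (is_derive_sub (is_derive_scale b (is_derive_scale a dV))
      (is_derive_cst (1 : R) (0 : R) 1)) dT1)) _.
  rewrite big_split/=.
  (* Writing [T 0] through [rho 0] leaves [field] the square root as a single atom. *)
  have -> : T 0 = rho 0 ^+ 2 / (2 * a) by rewrite rr; field; rewrite gt_eqF.
  by rewrite /s -/(rho 0); field; rewrite r0 gt_eqF.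
have [h10 h20] := local_min_derivative_test dh dh1 hmin.
by split => //; rewrite addrC.
Qed.

(** * The radiation metric and its connection *)

Lemma derive_coord (R : realType) (V : normedModType R) (m n : nat)
    (f : V -> 'M[R]_(m, n)) (x v : V) (i : 'I_m) (j : 'I_n) :
  derivable f x v -> 'D_v (fun y => f y i j) x = 'D_v f x i j.
Proof. by move=> df; rewrite (derive_mx df) mxE. Qed.

Section RadiationMetric.
Variables (R : realType) (m : nat) (a : R).
Hypothesis a0 : 0 < a.
Local Notation G := (@rw_metric R m (radiation_warping a)).
Implicit Types (y u v w : 'rV[R]_m.+1) (i j k l : 'I_m.+1).

Definition sdot u v : R := \sum_i u 0 (lift 0 i) * v 0 (lift 0 i).

Lemma radiation_metricE y i j : 0 < y 0 0 ->
  G y i j = (if i == 0 then -1 else 2 * a * y 0 0) *+ (i == j).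
Proof.
move=> y0; rewrite /rw_metric !mxE; case: eqP => // _.
by rewrite /radiation_warping sqr_sqrtr// !mulr_ge0// ltW.
Qed.

Lemma radiation_innerE y u v : 0 < y 0 0 ->
  inner G y u v = - (u 0 0 * v 0 0) + 2 * a * y 0 0 * sdot u v.
Proof.
move=> y0; rewrite /inner mxE big_ord_recl; congr (_ + _).
  rewrite /rw_metric mul_mx_diag !mxE/=; ring.
rewrite mulr_sumr; apply: eq_bigr => i _; rewrite mul_mx_diag !mxE/=.
rewrite /radiation_warping sqr_sqrtr ?mulr_ge0// ?ltW//; ring.
Qed.

Lemma near_time_gt0 y : 0 < y 0 0 -> \forall z \near y, 0 < (z : 'rV[R]_m.+1) 0 0.
Proof.
move=> y0; have /differentiable_continuous c := differentiable_coord y 0 0.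
exact: (cvgr_gt _ c _ y0).
Qed.

Lemma partial_radiation_metric y i j l : 0 < y 0 0 ->
  partial i (fun z => G z j l) y =
  (2 * a) *+ [&& i == 0, j == l & j != 0].
Proof.
move=> y0; rewrite /partial.
(* The formula for the entries holds only at positive time, [Num.sqrt] being 0 on negative numbers,
   so it is substituted near [y]. *)
rewrite (@near_eq_derive _ _ _ _
  (fun z : 'rV[R]_m.+1 => (if j == 0 then -1 else 2 * a * z 0 0) *+ (j == l))); last first.
  by apply: filterS (near_time_gt0 y0) => z z0; rewrite radiation_metricE.
case: (j == l); last by rewrite andbF mulr0n derive_cst.
case: (j == 0); first by rewrite !andbF mulr0n derive_cst.
have dc : derivable (fun z : 'rV[R]_m.+1 => z 0 0) y (delta_mx 0 i).
  exact/diff_derivable/differentiable_coord.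
transitivity ('D_(delta_mx 0 i) ((2 * a) \*: (fun z : 'rV[R]_m.+1 => z 0 0)) y).
  by [].
rewrite deriveZ// (@derive_coord _ _ _ _ id)// derive_id mxE eqxx/= eq_sym andbT.
by rewrite [_ *: _]mulr_natr.
Qed.

Lemma invmx_radiation_metric y : 0 < y 0 0 ->
  invmx (G y) = diag_mx (\row_i (if i == 0 then -1 else (2 * a * y 0 0)^-1)).
Proof.
move=> y0; set D := diag_mx _.
have GD : G y *m D = 1%:M.
  apply/matrixP => i j; rewrite mul_mx_diag mxE radiation_metricE// !mxE.
  have [<-|_] := eqVneq i j; last by rewrite mulr0n mul0r.
  case: (i == 0); rewrite ?mulrNN ?mulr1// mulfV// gt_eqF//.
  by rewrite !mulr_gt0.
by rewrite -[LHS]mulmx1 -GD mulmxA mulVmx ?mul1mx//; case: (mulmx1_unit GD).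
Qed.

(** The metric is diagonal, so only [l = k] survives in the sum. The non-zero symbols are rho rho' =
    a (time component, two equal space directions) and rho' / rho = 1 / (2 t) (space component, that
    direction and time). *)
Lemma radiation_christoffelE y k i j : 0 < y 0 0 ->
  christoffel G y k i j =
  2^-1 * (if k == 0 then -1 else (2 * a * y 0 0)^-1) *
  ((2 * a) *+ [&& i == 0, j == k & j != 0] +
   (2 * a) *+ [&& j == 0, i == k & i != 0] -
   (2 * a) *+ [&& k == 0, i == j & i != 0]).
Proof.
move=> y0; rewrite /christoffel invmx_radiation_metric// (bigD1 k)//=.
rewrite big1 ?addr0 => [|l lk].
  by rewrite !mxE eqxx mulr1n !partial_radiation_metric// mulrA.
by rewrite !mxE [k == l]eq_sym (negbTE lk) mulr0n mul0r.
Qed.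

Lemma christoffel_time y u w : 0 < y 0 0 ->
  \sum_i \sum_l christoffel G y 0 i l * u 0 i * w 0 l = a * sdot u w.
Proof.
move=> y0; rewrite big_ord_recl big1 ?add0r => [|l _]; last first.
  rewrite radiation_christoffelE//= !andbF andbN !mulr0n addr0 subr0 mulr0.
  by rewrite !mul0r.
rewrite mulr_sumr; apply: eq_bigr => i _; rewrite (bigD1 (lift 0 i))//=.
rewrite big1 ?addr0 => [|l li]; rewrite radiation_christoffelE//=.
  by rewrite eqxx !mulr0n mulr1n; field.
by rewrite andbF andbT [_ == l]eq_sym (negbTE li) !mulr0n addr0 subr0 mulr0 !mul0r.
Qed.

Lemma christoffel_space y u w (k : 'I_m) : 0 < y 0 0 ->
  \sum_i \sum_l christoffel G y (lift 0 k) i l * u 0 i * w 0 l =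
  (2 * y 0 0)^-1 * (u 0 0 * w 0 (lift 0 k) + u 0 (lift 0 k) * w 0 0).
Proof.
move=> y0; have an0 : a != 0 by rewrite gt_eqF.
have yn0 : y 0 0 != 0 by rewrite gt_eqF.
rewrite big_ord_recl (bigD1 (lift 0 k))//= [X in _ + X + _]big1 ?addr0; last first.
  move=> l lk; rewrite radiation_christoffelE//= (negbTE lk) !andbF !mulr0n.
  by rewrite addr0 subr0 mulr0 !mul0r.
rewrite (bigD1 k)//= [X in _ + (_ + X)]big1 ?addr0; last first.
  move=> i ik; rewrite big1// => l _; rewrite radiation_christoffelE//=.
  rewrite (inj_eq lift_inj) (negbTE ik) andbF !mulr0n !addr0 subr0 mulr0.
  by rewrite !mul0r.
rewrite (bigD1 0)//= [X in _ + (_ + X)]big1 ?addr0; last first.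
  move=> l l0; rewrite radiation_christoffelE//= (negbTE l0)/= !mulr0n.
  by rewrite !addr0 subr0 mulr0 !mul0r.
rewrite !radiation_christoffelE//= eqxx/= !mulr0n !mulr1n !addr0 !subr0.
rewrite add0r; field.
by rewrite an0 yn0.
Qed.

End RadiationMetric.

Lemma is_derive_coord (R : realType) (V : normedModType R) (m n : nat)
    (f : V -> 'M[R]_(m, n)) (x v : V) (d : 'M[R]_(m, n)) (i : 'I_m) (j : 'I_n) :
  is_derive x v f d -> is_derive x v (fun y => f y i j) (d i j).
Proof.
move=> [df <-]; apply: DeriveDef; last exact: derive_coord.
by move/derivable_mxP : df; apply.
Qed.

Lemma derive_near_cst (R : realType) (f : R -> R) (s c d : R) :
  (\forall r \near s, f r = c) -> is_derive s 1 f d -> d = 0.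
Proof.
move=> fc [_ <-]; rewrite (near_eq_derive (g := cst c)) ?derive_cst//.
Qed.

(** * Differentiating the metric along maps into the radiation model *)

Section RadiationHypersurface.
Variables (R : realType) (m : nat) (a : R).
Hypothesis a0 : 0 < a.
Local Notation G := (@rw_metric R m (radiation_warping a)).

Lemma sdotC (u v : 'rV[R]_m.+1) : sdot u v = sdot v u.
Proof. by apply: eq_bigr => i _; rewrite mulrC. Qed.

Lemma sdotDr (u v w : 'rV[R]_m.+1) : sdot u (v + w) = sdot u v + sdot u w.
Proof. by rewrite -big_split; apply: eq_bigr => i _; rewrite mxE mulrDr. Qed.

Lemma sdotZr (u v : 'rV[R]_m.+1) k : sdot u (k *: v) = k * sdot u v.
Proof. by rewrite mulr_sumr; apply: eq_bigr => i _; rewrite mxE mulrCA. Qed.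

Lemma is_derive_sdot (P Q : R -> 'rV[R]_m.+1) (s : R) (P1 Q1 : 'rV[R]_m.+1) :
  is_derive s 1 P P1 -> is_derive s 1 Q Q1 ->
  is_derive s 1 (fun r => sdot (P r) (Q r)) (sdot P1 (Q s) + sdot (P s) Q1).
Proof.
move=> dP dQ.
have := is_derive_sumE (fun i => is_derive_mul
  (is_derive_coord 0 (lift 0 i) dP) (is_derive_coord 0 (lift 0 i) dQ)).
move=> H; apply: (is_derive_eq H); rewrite -big_split; apply: eq_bigr => i _ /=.
ring.
Qed.

(** The metric depends on the base point through its time alone, whence the single extra term with
    [Y1 0 0]. *)
Lemma is_derive_radiation_inner (Y P Q : R -> 'rV[R]_m.+1) (s : R)
    (Y1 P1 Q1 : 'rV[R]_m.+1) :
  (\forall r \near s, 0 < Y r 0 0) ->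
  is_derive s 1 Y Y1 -> is_derive s 1 P P1 -> is_derive s 1 Q Q1 ->
  is_derive s 1 (fun r => inner G (Y r) (P r) (Q r))
    (- (P1 0 0 * Q s 0 0 + P s 0 0 * Q1 0 0) +
     2 * a * (Y1 0 0 * sdot (P s) (Q s) +
              Y s 0 0 * (sdot P1 (Q s) + sdot (P s) Q1))).
Proof.
move=> Ypos dY dP dQ.
apply: (@near_eq_is_derive _ _ _ (fun r => 2 * a * Y r 0 0 * sdot (P r) (Q r)
   - P r 0 0 * Q r 0 0)).
  by apply: filterS Ypos => r Yr; rewrite radiation_innerE// addrC.
have dY0 := is_derive_coord 0 0 dY; have dP0 := is_derive_coord 0 0 dP.
have dQ0 := is_derive_coord 0 0 dQ; have dS := is_derive_sdot dP dQ.
apply: is_derive_eq (is_derive_sub (is_derive_mul (is_derive_scale (2 * a) dY0)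
  dS) (is_derive_mul dP0 dQ0)) _.
ring.
Qed.

Lemma mul_cov_along (f n : 'rV[R]_m -> 'rV[R]_m.+1) (x v : 'rV[R]_m) k :
  (v *m cov_along G f n x) 0 k = (v *m 'J n x) 0 k +
  \sum_i \sum_l christoffel G (f x) k i l * (v *m 'J f x) 0 i * n x 0 l.
Proof.
rewrite [LHS]mxE /cov_along.
under eq_bigr do rewrite mxE.
move: ('J n x) ('J f x) (n x) (f x) => Jn Jf N y.
transitivity (\sum_j (v 0 j * Jn j k +
    \sum_i \sum_l v 0 j * (christoffel G y k i l * Jf j i * N 0 l))).
  apply: eq_bigr => j _; rewrite mulrDr; congr (_ + _).
  by rewrite mulr_sumr; apply: eq_bigr => i _; rewrite mulr_sumr.
rewrite big_split [(v *m Jn) 0 k]mxE; congr (_ + _).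
rewrite exchange_big; apply: eq_bigr => i _.
rewrite exchange_big; apply: eq_bigr => l _.
rewrite [(v *m Jf) 0 i]mxE mulr_sumr mulr_suml; apply: eq_bigr => j _.
ring.
Qed.

(** The factor 2 a t of the metric meets the factor 1 / (2 t) of the connection, so that no
    denominator is left. *)
Lemma radiation_inner_covariant (y p q N c u : 'rV[R]_m.+1) :
  0 < y 0 0 -> c 0 0 = p 0 0 + a * sdot q N ->
  (forall k, c 0 (lift 0 k) = p 0 (lift 0 k) +
    (2 * y 0 0)^-1 * (q 0 0 * N 0 (lift 0 k) + q 0 (lift 0 k) * N 0 0)) ->
  inner G y c u = - ((p 0 0 + a * sdot q N) * u 0 0) +
    2 * a * y 0 0 * sdot p u + a * (q 0 0 * sdot N u + N 0 0 * sdot q u).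
Proof.
move=> y0 c0 ck; have yn0 : y 0 0 != 0 by rewrite gt_eqF.
rewrite radiation_innerE// c0.
have -> : sdot c u = sdot p u +
    (2 * y 0 0)^-1 * (q 0 0 * sdot N u + N 0 0 * sdot q u).
  rewrite /sdot !mulr_sumr -big_split/= mulr_sumr -big_split/=.
  apply: eq_bigr => k _; rewrite ck; ring.
by field.
Qed.

Lemma inner_cov_along (f n : 'rV[R]_m -> 'rV[R]_m.+1) (x v : 'rV[R]_m)
    (u : 'rV[R]_m.+1) : 0 < f x 0 0 ->
  inner G (f x) (v *m cov_along G f n x) u =
  - (((v *m 'J n x) 0 0 + a * sdot (v *m 'J f x) (n x)) * u 0 0) +
  2 * a * f x 0 0 * sdot (v *m 'J n x) u +
  a * ((v *m 'J f x) 0 0 * sdot (n x) u + n x 0 0 * sdot (v *m 'J f x) u).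
Proof.
move=> fx; apply: radiation_inner_covariant => //.
  by rewrite mul_cov_along christoffel_time.
by move=> k; rewrite mul_cov_along christoffel_space.
Qed.

End RadiationHypersurface.

(** * The barrier at a local minimum *)

(* In the conformal time [eta = sqrt (2 t / a)] the metric is [a ^ 2 * eta ^ 2]
   times the Minkowski metric, and the barrier is, up to a constant,
   [a / 2 * (|x| ^ 2 - (eta - b) ^ 2)]: its level sets are hyperboloids. *)
Definition radiation_barrier (R : realType) (m : nat) (a b : R)
    (y : 'rV[R]_m.+1) : R :=
  a * 2^-1 * \sum_i y 0 (lift 0 i) ^+ 2 +
  b * Num.sqrt (2 * a * y 0 0) - y 0 0.

(** Dimension count: the kernel of a non-zero column has rank [m], the rank of [J], so it is the row
    space of [J]. *)
Lemma normal_complement (R : realType) (m : nat) (J : 'M[R]_(m, m.+1))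
    (c : 'cV[R]_m.+1) (u : 'rV[R]_m.+1) :
  row_free J -> J *m c = 0 -> c != 0 -> u *m c = 0 -> (u <= J)%MS.
Proof.
move=> Jfree Jc c0 uc.
have JK : (J <= kermx c)%MS by apply/sub_kermxP.
have uK : (u <= kermx c)%MS by apply/sub_kermxP.
have rc : \rank c = 1%N.
  apply/eqP; rewrite eqn_leq rank_leq_col lt0n mxrank_eq0//.
have := mxrank_leqif_eq JK; rewrite mxrank_ker rc subn1/=.
rewrite (eqP Jfree) => -[_]; rewrite eqxx => /esym/eqmxP JKe.
by rewrite JKe.
Qed.

Lemma Ck_on_near (R : realType) (V W : normedModType R) (k : nat) (U : set V)
    (f : V -> W) (x v : V) :
  open U -> U x -> Ck_on k.+1 U f ->
  \forall s \near (0 : R), U (x + s *: v) /\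
    is_derive s 1 (fun r : R => f (x + r *: v)) ('D_v f (x + s *: v)).
Proof.
move=> oU Ux [df _].
have Un : \forall s \near (0 : R), U (x + s *: v).
  have c : {for 0, continuous (fun s : R => x + s *: v)}.
    apply: continuousD; first exact: cst_continuous.
    exact: scalel_continuous.
  apply: c; rewrite scale0r addr0; exact: open_nbhs_nbhs.
apply: filterS Un => s Us; split => //; apply: is_derive_line.
by apply: df; rewrite inE.
Qed.

(* At a critical point the differential of the barrier is [mu] times the
   one-form [<N, .>] with [mu < 0], and its covariant Hessian restricted to the
   tangent space is [lam] times the induced metric with [lam < 0]. Hence the
   Hessian of the barrier on the hypersurface is the form associated with
   [lam + mu * S], where [S] is the shape operator. *)
Lemma radiation_comparison (R : realType) (m : nat) (a b : R)
    (y N : 'rV[R]_m.+1) (J Jn cov : 'M[R]_(m, m.+1))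
    (D : 'rV[R]_m -> 'rV[R]_m.+1) :
  let G := @rw_metric R m (radiation_warping a) in
  let sg := a / Num.sqrt (2 * a * y 0 0) in
  let dPhi (u : 'rV[R]_m.+1) := (b * sg - 1) * u 0 0 + a * sdot y u in
  (0 < m)%N -> 0 < a -> 0 < y 0 0 -> row_free J -> 2 < b * sg ->
  (forall v, v != 0 -> 0 < inner G y (v *m J) (v *m J)) ->
  inner G y N N = -1 -> (forall v, inner G y N (v *m J) = 0) ->
  inner G y N (dt R m) <= -1 ->
  (forall v u, inner G y (v *m cov) u =
    - (((v *m Jn) 0 0 + a * sdot (v *m J) N) * u 0 0) +
    2 * a * y 0 0 * sdot (v *m Jn) u +
    a * ((v *m J) 0 0 * sdot N u + N 0 0 * sdot (v *m J) u)) ->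
  (forall v, - ((v *m Jn) 0 0 * N 0 0 + N 0 0 * (v *m Jn) 0 0) +
     2 * a * ((v *m J) 0 0 * sdot N N +
              y 0 0 * (sdot (v *m Jn) N + sdot N (v *m Jn))) = 0) ->
  (forall v, - ((v *m Jn) 0 0 * (v *m J) 0 0 + N 0 0 * D v 0 0) +
     2 * a * ((v *m J) 0 0 * sdot N (v *m J) +
              y 0 0 * (sdot (v *m Jn) (v *m J) + sdot N (D v))) = 0) ->
  (forall v, dPhi (v *m J) = 0) ->
  (forall v, 0 <= - b * sg / (2 * y 0 0) * (v *m J) 0 0 ^+ 2
       + a * sdot (v *m J) (v *m J) + dPhi (D v)) ->
  \tr (- cov *m pinvmx J) < 0.
Proof.
move=> G sg dPhi m0 a0 y0 Jfree bsig riem NN NJ Nfut covE dNN dNJ crit hess.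
have yn0 : y 0 0 != 0 by rewrite gt_eqF.
have innE u w : inner G y u w = - (u 0 0 * w 0 0) + 2 * a * y 0 0 * sdot u w.
  exact: radiation_innerE.
have innC u w : inner G y u w = inner G y w u.
  by rewrite !innE sdotC mulrC.
(* [c] is the covector of [N]; its kernel is the orthogonal complement of [N]. *)
pose c : 'cV[R]_m.+1 := G y *m N^T.
have innc u : inner G y u N = (u *m c) 0 0 by rewrite /c /inner mulmxA.
have cP n (B : 'M[R]_(n, m.+1)) :
    (forall v : 'rV_n, inner G y (v *m B) N = 0) -> B *m c = 0.
  move=> BN; apply/row_matrixP => i; rewrite row_mul row0 rowE.
  by apply/matrixP => j k; rewrite !ord1 -innc BN mxE.
have Jc : J *m c = 0 by apply: cP => v; rewrite innC.
have c0 : c != 0.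
  apply/eqP => c0; move: NN; rewrite innc c0 mulmx0 mxE => /eqP.
  by rewrite eq_sym oppr_eq0 oner_eq0.
have tan u : inner G y u N = 0 -> (u <= J)%MS.
  move=> uN; apply: normal_complement Jfree Jc c0 _.
  by apply/matrixP => i j; rewrite !ord1 -innc uN mxE.
(* The vector [u + <N, u> N] is orthogonal to [N] because [<N, N> = -1]; hence it is tangent, and
   [dPhi] kills it. *)
have dPhiE u : dPhi u = inner G y N u * - dPhi N.
  have : ((u + inner G y N u *: N)%R <= J)%MS.
    apply: tan; rewrite innc mulmxDl -scalemxAl mxE [X in _ + X]mxE -!innc NN.
    by rewrite mulrN1 [inner G y u N]innC subrr.
  case/submxP => w wE; have := crit w; rewrite -wE /dPhi sdotDr sdotZr !mxE.
  move=> e; apply/eqP; rewrite -subr_eq0 -[X in _ == X]e; apply/eqP; ring.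
pose mu := - dPhi N.
(* This is [dPhiE] at [dt]. As [N 0 0 >= 1], a non-negative [mu] would give [b * sg <= 1]. *)
have bE : b * sg = 1 - mu * N 0 0.
  have e0 u : sdot u (dt R m) = 0.
    by rewrite /sdot big1// => i _; rewrite mxE andbF mulr0.
  have := dPhiE (dt R m); rewrite -/mu /dPhi innE !e0 !mxE/=.
  by rewrite !mulr0 !mulr1 !addr0 => /eqP; rewrite subr_eq => /eqP ->; ring.
have mu0 : mu < 0.
  rewrite ltNge; apply/negP => mu0; have N0 : 1 <= N 0 0.
    have := Nfut; rewrite innE /sdot big1 => [|i _]; last first.
      by rewrite mxE andbF mulr0.
    by rewrite mxE/= mulr1 mulr0 addr0 lerN2.
  have := bsig; rewrite bE; have : 0 <= mu * N 0 0.
    by rewrite mulr_ge0// (le_trans _ N0).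
  lra.
(* The Hessian of the barrier in the Minkowski metric is the metric times 1 / (2 t); the conformal
   change of connection adds (1 - b sg) / (2 t) on the tangent space. *)
pose lam := (2 - b * sg) / (2 * y 0 0).
have lam0 : lam < 0 by rewrite pmulr_llt0 ?invr_gt0 ?mulr_gt0// subr_lt0.
(* [<cov, N>] is half the derivative of the constant [<N, N>]. *)
have covJ : (cov <= J)%MS.
  apply/row_subP => i; apply: tan; rewrite rowE covE.
  have := dNN (delta_mx 0 i); rewrite [sdot N (_ *m Jn)]sdotC => e.
  apply/eqP; rewrite -[X in _ == X](mulr0 2^-1) -e; apply/eqP; by field.
set S := - cov *m pinvmx J.
have SJ : S *m J = - cov.
  by rewrite /S mulmxKpV// eqmx_opp.
move: S SJ => S SJ.
pose g := J *m G y *m J^T.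
have gE v : (v *m g *m v^T) 0 0 = inner G y (v *m J) (v *m J).
  by rewrite /inner trmx_mul !mulmxA.
have Gsym : (G y)^T = G y by rewrite /G /rw_metric tr_diag_mx.
have gsym : g^T = g by rewrite /g !trmx_mul trmxK Gsym mulmxA.
have : 0 <= \tr (lam%:M + mu *: S).
  apply: (mxtrace_ge0_of_form gsym) => [v v0|v]; first by rewrite gE riem.
  have -> : (v *m (lam%:M + mu *: S) *m g *m v^T) 0 0 =
      lam * inner G y (v *m J) (v *m J) - mu * inner G y (v *m cov) (v *m J).
    rewrite mulmxDr mul_mx_scalar -scalemxAr !mulmxDl -!scalemxAl.
    rewrite mxE [X in X + _]mxE [X in _ + X]mxE gE.
    congr (_ + _); rewrite -mulrN; congr (_ * _).
    rewrite /g !mulmxA -[v *m S *m J]mulmxA SJ.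
    by rewrite mulmxN !mulNmx mxE /inner trmx_mul !mulmxA.
  (* [dPhi (D v)] is [mu * <N, D v>], and [dNJ], the derivative of [<N, v J> = 0], expresses
     [<N, D v>] through the first derivatives of [N]. *)
  have := hess v; rewrite dPhiE -/mu covE !innE /lam mulNr bE [sdot (_ *m J) N]sdotC.
  have := NJ v; have := dNJ v; rewrite innE.
  move: (v *m J) (v *m Jn) (D v) => q p d.
  move=> e1 e2 h; have N0 := mulr_gt0 a0 y0.
  have e3 : sdot N q = N 0 0 * q 0 0 / (2 * a * y 0 0).
    apply: (mulfI (x := 2 * a * y 0 0)); first by rewrite gt_eqF// -mulrA mulr_gt0.
    rewrite [RHS]mulrC divfK; last by rewrite gt_eqF// -mulrA mulr_gt0.
    by lra.
  have e4 : - (N 0 0 * d 0 0) + 2 * a * y 0 0 * sdot N d =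
      p 0 0 * q 0 0 - 2 * a * q 0 0 * sdot N q - 2 * a * y 0 0 * sdot p q.
    by lra.
  apply: (le_trans h); rewrite e4 e3 le_eqVlt; apply/orP; left; apply/eqP.
  by field; rewrite yn0 gt_eqF.
rewrite linearD/= linearZ/= mxtrace_scalar => h.
(* As [m * lam] is negative, [mu * \tr S] has to be positive, and [mu < 0] then fixes the sign of
   the trace. *)
have : lam *+ m < 0 by rewrite pmulrn_llt0.
move=> lm; rewrite -(nmulr_lgt0 _ mu0); lra.
Qed.

(** Straight lines of the chart suffice as test curves: their acceleration may have a tangential
    part, but the differential of the barrier annihilates it at a critical point. *)
Lemma radiation_no_local_min (R : realType) (m : nat) (a b : R)
    (U : set 'rV[R]_m) (f n : 'rV[R]_m -> 'rV[R]_m.+1) (x : 'rV[R]_m) :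
  let G := @rw_metric R m (radiation_warping a) in
  (0 < m)%N -> 0 < a -> open U -> U x -> Ck_on 2 U f -> Ck_on 1 U n ->
  (forall z, U z -> 0 < f z 0 0) ->
  (forall v, v != 0 -> 0 < inner G (f x) (v *m 'J f x) (v *m 'J f x)) ->
  row_free ('J f x) ->
  (forall z, U z -> inner G (f z) (n z) (n z) = -1) ->
  (forall z v, U z -> inner G (f z) (n z) (v *m 'J f z) = 0) ->
  inner G (f x) (n x) (dt R m) <= -1 ->
  2 < b * (a / Num.sqrt (2 * a * f x 0 0)) ->
  (\forall z \near x, radiation_barrier a b (f x) <= radiation_barrier a b (f z)) ->
  \tr (- cov_along G f n x *m pinvmx ('J f x)) < 0.
Proof.
move=> G m0 a0 oU Ux fC nC fpos riem Jfree nunit north nfut bsig fmin.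
have df z v : U z -> 'D_v f z = v *m 'J f z.
  by move=> Uz; apply: deriveEjacobian; apply: fC.1; rewrite inE.
have dn z v : U z -> 'D_v n z = v *m 'J n z.
  by move=> Uz; apply: deriveEjacobian; apply: nC.1; rewrite inE.
have x0 v : x + (0 : R) *: v = x by rewrite scale0r addr0.
have nf v := Ck_on_near v oU Ux fC.
have nn v := Ck_on_near v oU Ux nC.
have fC1 v : Ck_on 1 U ('D_v f) := fC.2 v.
have nf1 v := Ck_on_near v oU Ux (fC1 v).
have f1 v : is_derive (0 : R) 1 (fun s : R => f (x + s *: v)) (v *m 'J f x).
  by have [_] := nbhs_singleton (nf v); rewrite x0 df.
have f2 v : is_derive (0 : R) 1 (fun s : R => 'D_v f (x + s *: v))
    ('D_v ('D_v f) x).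
  by have [_] := nbhs_singleton (nf1 v); rewrite x0.
have n1 v : is_derive (0 : R) 1 (fun s : R => n (x + s *: v)) (v *m 'J n x).
  by have [_] := nbhs_singleton (nn v); rewrite x0 dn.
have fp v : \forall s \near (0 : R), 0 < f (x + s *: v) 0 0.
  by apply: filterS (nf v) => s [Us _]; exact: fpos.
have var v := @radiation_second_variation R m a b
    (fun s => f (x + s *: v) 0 0) (fun s => ('D_v f) (x + s *: v) 0 0)
    (('D_v ('D_v f) x) 0 0)
    (fun i s => f (x + s *: v) 0 (lift 0 i))
    (fun i s => ('D_v f) (x + s *: v) 0 (lift 0 i))
    (fun i => 'D_v ('D_v f) x 0 (lift 0 i)) a0.
have {}var v : (b * (a / Num.sqrt (2 * a * f x 0 0)) - 1) * (v *m 'J f x) 0 0 +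
      a * sdot (f x) (v *m 'J f x) = 0 /\
    0 <= - b * (a / Num.sqrt (2 * a * f x 0 0)) / (2 * f x 0 0) *
           (v *m 'J f x) 0 0 ^+ 2
       + a * sdot (v *m 'J f x) (v *m 'J f x) +
      ((b * (a / Num.sqrt (2 * a * f x 0 0)) - 1) * ('D_v ('D_v f) x) 0 0 +
      a * sdot (f x) ('D_v ('D_v f) x)).
  have [||||] := var v; rewrite ?x0.
  - apply: filterS (nf v) => s [Us ds]; split; first exact: fpos.
      exact: is_derive_coord ds.
    by move=> i; exact: is_derive_coord ds.
  - exact: is_derive_coord (f2 v).
  - by move=> i; exact: is_derive_coord (f2 v).
  - have c : {for 0, continuous (fun s : R => x + s *: v)}.
      apply: continuousD; first exact: cst_continuous.
      exact: scalel_continuous.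
    have fm : nbhs (x + (0 : R) *: v)
        [set z | radiation_barrier a b (f x) <= radiation_barrier a b (f z)].
      by rewrite x0.
    exact: c _ fm.
  move=> e1 e2; rewrite -df//; split; first exact: e1.
  apply: (le_trans e2); rewrite le_eqVlt; apply/orP; left; apply/eqP.
  rewrite -!addrA; congr (_ + _); rewrite addrCA; congr (_ + _); congr (_ * _).
apply: (@radiation_comparison _ _ a b (f x) (n x) ('J f x) ('J n x) _
  (fun v => 'D_v ('D_v f) x)) => //.
- exact: fpos.
- exact: nunit.
- by move=> v; exact: north.
- by move=> v u; apply: inner_cov_along => //; exact: fpos.
(* This goal and the next are derivatives of constants along the line: [<N, N> = -1], then
   [<N, 'D_v f> = 0]. *)
- move=> v; have := is_derive_radiation_inner a0 (fp v) (f1 v) (n1 v) (n1 v).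
  rewrite /= !x0; apply: derive_near_cst.
  by apply: filterS (nn v) => s [Us _]; exact: nunit.
- move=> v; have := is_derive_radiation_inner a0 (fp v) (f1 v) (n1 v) (f2 v).
  rewrite /= !x0 df//; apply: derive_near_cst.
  by apply: filterS (nf v) => s [Us _]; rewrite df//; exact: north.
- by move=> v; have [] := var v.
- by move=> v; have [] := var v.
Qed.

(** * The inverse function theorem *)

Lemma MVT_unit_interval (R : realType) (h dh : R -> R) :
  (forall s : R, s \in `[0, 1]%R -> is_derive s 1 h (dh s)) ->
  exists2 s : R, s \in `[0, 1]%R & h 1 - h 0 = dh s.
Proof.
move=> dhP.
have dhO (s : R) : s \in `]0, 1[%R -> is_derive s 1 h (dh s).
  by move=> /subset_itv_oo_cc; exact: dhP.
have ch : {within `[0, 1], continuous h}.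
  apply: derivable_within_continuous => s sI.
  have [hs _] := dhP s sI.
  exact: hs.
have [s sI e] := MVT ltr01 dhO ch.
exists s; first exact: subset_itv_oo_cc.
by rewrite e subr0 mulr1.
Qed.

Lemma ball_segment (R : realType) (V : normedModType R) (c x y : V)
    (r s : R) : ball c r x -> ball c r y -> 0 <= s <= 1 ->
  ball c r (y + s *: (x - y)).
Proof.
rewrite -!ball_normE/= => xr yr /andP[s0 s1].
have -> : c - (y + s *: (x - y)) = (1 - s) *: (c - y) + s *: (c - x).
  rewrite scalerBl scale1r opprD addrA -[RHS]addrA; congr (_ + _).
  rewrite [RHS]addrC -scalerBr -scalerN; congr (_ *: _).
  by rewrite opprB [RHS]addrC opprB subrKA.
rewrite (le_lt_trans (ler_normD _ _))// !normrZ !ger0_norm ?subr_ge0//.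
(* Strictness will come from the term with weight [s], so [s = 0] is treated apart. *)
have [->|s00] := eqVneq s 0; first by rewrite subr0 mul1r mul0r addr0.
rewrite (@lt_le_trans _ _ ((1 - s) * r + s * r))//; last first.
  by rewrite -mulrDl subrK mul1r.
rewrite ler_ltD// ?ler_wpM2l ?subr_ge0// ?ltW//.
by rewrite ltr_pM2l// lt_neqAle eq_sym s00.
Qed.

(** * Maximum norm and epsilon form of differentiability *)

Section RowVectorBounds.
Variables (R : realType).

Lemma coord_le_norm m n (A : 'M[R]_(m, n)) i j : `|A i j| <= `|A|.
Proof. by rewrite [leRHS]mx_normrE; exact: (le_bigmax _ _ (i, j)). Qed.

Lemma norm_le_coord m n (A : 'M[R]_(m, n)) (c : R) :
  0 <= c -> (forall i j, `|A i j| <= c) -> `|A| <= c.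
Proof.
move=> c0 Ac; rewrite [leLHS]mx_normrE; exact: bigmax_le.
Qed.

Lemma norm_mulmx_le m n (v : 'rV[R]_m) (B : 'M[R]_(m, n)) :
  `|v *m B| <= (\sum_i `|row i B|) * `|v|.
Proof.
rewrite mulmx_sum_row mulr_suml; apply: le_trans (ler_norm_sum _ _ _) _.
apply: ler_sum => i _; rewrite normrZ mulrC ler_wpM2l//; exact: coord_le_norm.
Qed.

Lemma mulmxr_bounded m n (B : 'M[R]_(m, n)) :
  exists2 K, 0 < K & forall v : 'rV[R]_m, `|v *m B| <= K * `|v|.
Proof.
exists (1 + \sum_i `|row i B|) => [|v].
  by rewrite ltr_pwDl// sumr_ge0.
apply: le_trans (norm_mulmx_le v B) _.
by rewrite ler_wpM2r// lerDr.
Qed.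

Lemma mulmxr_continuous m n (B : 'M[R]_(m, n)) :
  continuous (fun v : 'rV[R]_m => v *m B).
Proof.
have [K K0 KB] := mulmxr_bounded B.
apply: (bounded_linear_continuous (f := mulmxr B)); apply/linear_boundedP.
exists K; split=> [|r Kr v]; first exact: num_real.
by rewrite (le_trans (KB v))// ler_wpM2r// ltW.
Qed.

Lemma differentiable_eps (V W : normedModType R) (f : V -> W) (x : V) :
  differentiable f x -> forall e, 0 < e ->
  \forall h \near 0, `|f (x + h) - f x - 'd f x h| <= e * `|h|.
Proof.
move=> /diff_locally /eqaddoP fx e e0; have := fx e e0.
apply: filterS => h /=; rewrite -![(_ + _ : _ -> _) _]/(_ + _).
rewrite -![(- _ : _ -> _) _]/(- _) -![(_ + _ : _ -> _) _]/(_ + _) /=.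
by rewrite opprD addrA [h + x]addrC.
Qed.

Lemma eps_differentiable (V W : normedModType R) (f : V -> W)
    (df : {linear V -> W}) (x : V) :
  continuous df ->
  (forall e, 0 < e ->
    \forall h \near 0, `|f (x + h) - f x - df h| <= e * `|h|) ->
  is_diff x f df.
Proof.
move=> cdf H.
have fE : f \o shift x = cst (f x) + df +o_ 0 id.
  apply/eqaddoP => e e0; apply: filterS (H e e0) => h /=.
  rewrite -![(_ + _ : _ -> _) _]/(_ + _).
  rewrite -![(- _ : _ -> _) _]/(- _) -![(_ + _ : _ -> _) _]/(_ + _) /=.
  by rewrite opprD addrA [h + x]addrC.
have dE := diff_unique cdf fE.
by apply: DiffDef => //; apply/diff_locallyP; rewrite dE.
Qed.

(** The mean value theorem can be applied entry by entry without loss in [c], because the norm is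
    the maximum of the absolute values of the entries. *)
Lemma lipschitz_of_derive m n (F : 'rV[R]_m -> 'rV[R]_n) (x0 : 'rV[R]_m)
    (r c : R) : 0 <= c ->
  (forall x, ball x0 r x -> differentiable F x) ->
  (forall x v, ball x0 r x -> `|'D_v F x| <= c * `|v|) ->
  forall x y, ball x0 r x -> ball x0 r y -> `|F x - F y| <= c * `|x - y|.
Proof.
move=> c0 dF Fc x y xr yr; apply: norm_le_coord => [|i j].
  by rewrite mulr_ge0.
have seg (s : R) : s \in `[0, 1]%R -> ball x0 r (y + s *: (x - y)).
  by rewrite in_itv/=; exact: ball_segment.
pose h (s : R) : R := F (y + s *: (x - y)) i j.
pose dh (s : R) : R := 'D_(x - y) F (y + s *: (x - y)) i j.
have dhP (s : R) : s \in `[0, 1]%R -> is_derive s 1 h (dh s).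
  by move=> /seg sb; exact: is_derive_coord (is_derive_line (dF _ sb)).
have [s sI e] := MVT_unit_interval dhP.
have {}e : F x i j - F y i j = dh s.
  have h1 : h 1 = F x i j by rewrite /h scale1r addrC subrK.
  have h0 : h 0 = F y i j by rewrite /h scale0r addr0.
  by rewrite -h1 -h0 e.
rewrite !mxE e.
apply: le_trans (coord_le_norm _ _ _) _; apply: Fc; apply: seg.
exact: sI.
Qed.

End RowVectorBounds.

Lemma norm_le_dist (R : realType) (V : normedModType R) (u v : V) (c : R) :
  `|v - u| <= c -> `|u| <= `|v| + c.
Proof.
move=> vu; rewrite -{1}[u](subKr v) (le_trans (ler_normB _ _))//.
by rewrite lerD2l.
Qed.

Lemma derive_sub_linear (R : realType) m (f : 'rV[R]_m -> 'rV[R]_m)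
    (A : 'M[R]_m) (x : 'rV[R]_m) :
  differentiable f x ->
  differentiable (fun z => f z - z *m A) x /\
  forall v, 'D_v (fun z => f z - z *m A) x = v *m 'J f x - v *m A.
Proof.
move=> df; have cA := @mulmxr_continuous R m m A.
have dA : differentiable (mulmxr A) x by exact: linear_differentiable.
have D : differentiable (fun z => f z - z *m A) x by exact: differentiableB.
split => // v; rewrite -(deriveEjacobian v df).
have -> : v *m A = 'D_v (mulmxr A) x by rewrite deriveE// diff_lin.
have := @deriveB _ _ _ f (mulmxr A) x v (diff_derivable df) (diff_derivable dA).
exact.
Qed.

Section InverseFunction.
Variables (R : realType) (m : nat) (U : set 'rV[R]_m).
Variables (f : 'rV[R]_m -> 'rV[R]_m) (x0 : 'rV[R]_m).
Hypotheses (oU : open U) (Ux0 : U x0) (fC : Ck_on 1 U f).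
Variable A : 'M[R]_m.
Hypotheses (AE : 'J f x0 = A) (Jf : A \in unitmx).

Lemma jacobian_near (e : R) : 0 < e ->
  \forall x \near x0, U x /\ forall v : 'rV[R]_m, `|v *m 'J f x - v *m A| <= e * `|v|.
Proof.
move=> e0.
have df x : U x -> differentiable f x by move=> Ux; apply: fC.1; rewrite inE.
have dJ x (i : 'I_m) : U x -> row i ('J f x) = 'D_(delta_mx (0 : 'I_1) i) f x.
  by move=> Ux; rewrite rowE (deriveEjacobian _ (df _ Ux)).
(* The [m] rows add up to at most [e]; the denominator [m + 1] keeps the quotient positive for
   [m = 0]. *)
have e1 : 0 < e / (m%:R + 1) by rewrite divr_gt0// ltr_wpDl.
have H (i : 'I_m) : \forall x \near x0,
    `|'D_(delta_mx (0 : 'I_1) i) f x0 - 'D_(delta_mx (0 : 'I_1) i) f x| <=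
    e / (m%:R + 1).
  have c : {for x0, continuous ('D_(delta_mx (0 : 'I_1) i) f)}.
    by apply: fC.2; rewrite inE.
  by have /(@cvgrPdist_le _ _ _ (nbhs x0))/(_ _ e1) := c.
have Un : \forall x \near x0, U x by exact: open_nbhs_nbhs.
near=> x; have Ux : U x by near: x.
split => // v.
rewrite -mulmxBr (le_trans (norm_mulmx_le _ _))// ler_wpM2r//.
apply: (@le_trans _ _ (\sum_(i < m) (e / (m%:R + 1)))).
  apply: ler_sum => i _; have -> : row i ('J f x - A) = row i ('J f x) - row i A.
    exact: raddfB.
  have -> : row i ('J f x) - row i A =
      'D_(delta_mx (0 : 'I_1) i) f x - 'D_(delta_mx (0 : 'I_1) i) f x0.
    by rewrite -(dJ x i Ux) -(dJ x0 i Ux0) AE.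
  rewrite distrC.
  by move: i; near: x; exact: filter_forall.
rewrite sumr_const card_ord -(mulr_natr (e / _)) mulrAC ler_pdivrMr ?ltr_wpDl//.
by rewrite ler_pM2l// lerDl.
Unshelve. all: by end_near. Qed.

(** [f] is the linear map [A] plus a map [F] with Lipschitz constant [e = 1 / (2 k)], where [k]
    bounds the inverse of [A]. As [k * e = 1 / 2], the share of [F] is absorbed on the left, which
    doubles the constant: [K = 2 k]. *)
Lemma inverse_function_setup :
  exists r K : R, [/\ 0 < r /\ 0 < K,
    forall x, ball x0 (2 * r) x -> U x,
    forall x (v : 'rV[R]_m), ball x0 (2 * r) x -> `|v| <= K * `|v *m 'J f x|,
    forall x y, ball x0 (2 * r) x -> ball x0 (2 * r) y ->
      `|x - y| <= K * `|f x - f y|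
    & forall y, ball (f x0) (r / K) y ->
        exists x, ball x0 (2 * r) x /\ f x = y].
Proof.
have [k k0 Ak] := mulmxr_bounded (invmx A).
have vA (v : 'rV[R]_m) : `|v| <= k * `|v *m A|.
  by rewrite -{1}[v](mulmxK Jf).
pose e := (2 * k)^-1.
have e0 : 0 < e by rewrite invr_gt0 mulr_gt0.
have [s /= s0 sb] := (nbhs_ballP _ _).1 (jacobian_near e0).
pose r := s / 2; have r0 : 0 < r by rewrite divr_gt0.
have rs : 2 * r = s by rewrite /r; field.
exists r, (2 * k); rewrite rs.
have sU x : ball x0 s x -> U x by move=> /sb[].
have sJ x (v : 'rV[R]_m) : ball x0 s x -> `|v *m 'J f x - v *m A| <= e * `|v|.
  by move=> /sb[_ /(_ v)].
have df x : ball x0 s x -> differentiable f x.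
  by move=> /sU Ux; apply: fC.1; rewrite inE.
pose F z := f z - z *m A.
have dF x : ball x0 s x -> differentiable F x.
  by move=> xs; exact: (derive_sub_linear A (df _ xs)).1.
have DF x (v : 'rV[R]_m) : ball x0 s x -> `|'D_v F x| <= e * `|v|.
  by move=> xs; rewrite (derive_sub_linear A (df _ xs)).2 sJ.
have LF := lipschitz_of_derive (ltW e0) dF DF.
have ke : k * e = 2^-1 by rewrite /e; field; rewrite gt_eqF.
split; first by split=> //; rewrite mulr_gt0.
- exact: sU.
- move=> x v xs.
  have h1 := vA v; have h2 := sJ x v xs.
  have h3 : `|v *m A| <= `|v *m 'J f x| + e * `|v|.
    exact: norm_le_dist h2.
  have h4 : k * `|v *m A| <= k * `|v *m 'J f x| + 2^-1 * `|v|.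
    by rewrite -ke -mulrA -mulrDr ler_pM2l.
  lra.
- move=> x y xs ys; have h1 := vA (x - y); have h2 := LF x y xs ys.
  have h3 : `|(x - y) *m A| <= `|f x - f y| + e * `|x - y|.
    have -> : (x - y) *m A = (f x - f y) - (F x - F y).
      by rewrite /F mulmxBl; apply/matrixP => p q; rewrite !mxE; ring.
    by rewrite (le_trans (ler_normB _ _))// lerD2l.
  have h4 : k * `|(x - y) *m A| <= k * `|f x - f y| + 2^-1 * `|x - y|.
    by rewrite -ke -mulrA -mulrDr ler_pM2l.
  lra.
move=> y; rewrite -ball_normE/= => yr.
(* [P] is a contraction of the closed ball [B]; its fixed point is obtained as a
   minimum of [|P x - x|] on the compact set [B]. *)
pose P x := (y - F x) *m invmx A.
have PL x z : ball x0 s x -> ball x0 s z -> `|P x - P z| <= 2^-1 * `|x - z|.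
  move=> xs zs; rewrite /P -mulmxBl (le_trans (Ak _))// -ke -mulrA ler_pM2l//.
  have -> : y - F x - (y - F z) = - (F x - F z).
    by rewrite [y - F x]addrC addrKA opprK [RHS]opprB [LHS]addrC.
  by rewrite normrN LF.
have PE x : P x - x = (y - f x) *m invmx A.
  rewrite /P /F opprB addrA -[in X in _ - X = _](mulmxK Jf x) -mulmxBl.
  congr (_ *m _); apply/matrixP => p q; rewrite !mxE; ring.
have B0 := ballxx x0 s0.
pose B := [set x | `|x0 - x| <= r].
have Bs x : B x -> ball x0 s x.
  rewrite /B -ball_normE/= => /le_lt_trans; apply.
  by rewrite /r ltr_pdivrMr// ltr_pMr ?ltr1n.
(* Two halves of [r]: [P x] is within [r / 2] of [P x0] by contraction, and [P x0] is within [r / 2]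
   of [x0] because [y] is within [r / K] of [f x0]. *)
have PB x : B x -> B (P x).
  move=> Bx; rewrite /B/=.
  have -> : x0 - P x = (P x0 - P x) - (P x0 - x0) by rewrite opprB [RHS]addrC subrKA.
  rewrite (le_trans (ler_normB _ _))// PE.
  have h1 := PL x0 x B0 (Bs _ Bx).
  have h2 : `|(y - f x0) *m invmx A| <= k * `|f x0 - y|.
    by rewrite distrC; exact: Ak.
  have h3 : k * `|f x0 - y| <= r / 2.
    move: yr; rewrite ltr_pdivlMr ?mulr_gt0// => yr; lra.
  move: Bx; rewrite /B/= => Bx; lra.
have Bc : compact B.
  apply: bounded_closed_compact; last exact: closed_closed_ball_.
  exists (`|x0| + r); split; first exact: num_real.
  move=> M Mr x Bx; apply: le_trans (ltW Mr).
  by rewrite -[x](subKr x0) (le_trans (ler_normB _ _))// lerD2l.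
have Bn : B !=set0 by exists x0; rewrite /B/= subrr normr0 ltW.
have [p pB pmin] : exists2 p, p \in B & forall t, t \in B -> `|P p - p| <= `|P t - t|.
  apply: EVT_min_rV => //.
  apply: continuous_in_subspaceT => x; rewrite inE => /Bs xs.
  have cf : {for x, continuous (fun z => y - f z)}.
    by apply: continuousB; [exact: cst_continuous|exact: differentiable_continuous (df x xs)].
  have cP : {for x, continuous (fun z => P z - z)}.
    rewrite (_ : (fun z => P z - z) = fun z => (y - f z) *m invmx A); last first.
      by apply/funext => z; exact: PE.
    apply: (@continuous_comp _ _ _ (fun z => y - f z) (mulmx^~ (invmx A)) x cf).
    exact: mulmxr_continuous.
  by apply: (@continuous_comp _ _ _ (fun z => P z - z) Num.norm x cP);
     exact: norm_continuous.
move: pB; rewrite inE => pB.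
(* The competitor [P p] is displaced at most half as far as [p], so minimality forces the
   displacement of [p] to be 0. *)
have := pmin (P p); rewrite inE => /(_ (PB _ pB)) m1.
have m2 := PL _ _ (Bs _ (PB _ pB)) (Bs _ pB).
have : `|P p - p| <= 0 by lra.
rewrite normr_le0 PE => /eqP/(congr1 (mulmx^~ A)).
rewrite mulmxKV// mul0mx => /eqP; rewrite subr_eq0 => /eqP yE.
by exists p; rewrite yE; split=> //; have := Bs _ pB; rewrite -ball_normE.
Qed.

End InverseFunction.

Lemma unitmx_of_bound (R : realType) m (B : 'M[R]_m) (K : R) :
  (forall v : 'rV[R]_m, `|v| <= K * `|v *m B|) -> B \in unitmx.
Proof.
move=> KB; rewrite -row_free_unit -kermx_eq0; apply/eqP/row_matrixP => i.
apply/eqP; rewrite row0 -normr_le0 (le_trans (KB _))//.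
by rewrite -row_mul mulmx_ker row0 normr0 mulr0.
Qed.

(** With [q = g (y + h) - g y], the error [q - h B^-1] is [- (h - q B) B^-1], and [h - q B] is the
    remainder of [f], of order o(|q|); the Lipschitz bound on [g] turns this into o(|h|). *)
Lemma inverse_differential (R : realType) m (f g : 'rV[R]_m -> 'rV[R]_m)
    (y : 'rV[R]_m) (B : 'M[R]_m) (d K : R) :
  0 < d -> 0 < K -> differentiable f (g y) -> 'J f (g y) = B -> B \in unitmx ->
  (forall z, ball y d z -> f (g z) = z /\ `|g z - g y| <= K * `|z - y|) ->
  differentiable g y /\ forall v : 'rV[R]_m, 'D_v g y = v *m invmx B.
Proof.
move=> d0 K0 df JB Bu gP.
have [k k0 Bk] := mulmxr_bounded (invmx B).
have dfB h : 'd f (g y) h = h *m B.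
  by rewrite -deriveE// (deriveEjacobian _ df) JB.
have dg : is_diff y g (mulmxr (invmx B)).
  apply: eps_differentiable; first exact: mulmxr_continuous.
  move=> e e0.
  pose e' := e / (k * K).
  have e'0 : 0 < e' by rewrite divr_gt0// mulr_gt0.
  have [s /= s0 sb] := (nbhs_ballP _ _).1 (differentiable_eps df e'0).
  apply/nbhs_ballP; exists (Num.min d (s / K)).
    by rewrite /= lt_min d0 divr_gt0.
  move=> h; rewrite -ball_normE/= sub0r normrN lt_min => /andP[hd hs].
  have yh : ball y d (y + h) by rewrite -ball_normE/= opprD addNKr normrN.
  have [fg gL] := gP _ yh.
  have yd : ball y d y by exact: ballxx.
  have [fgy _] := gP _ yd.
  rewrite addrAC subrr add0r in gL.
  set q := g (y + h) - g y in gL *.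
  have qs : ball 0 s q.
    rewrite -ball_normE/= sub0r normrN (le_lt_trans gL)//.
    by rewrite -ltr_pdivlMl// mulrC.
  have qE : g y + q = g (y + h) by rewrite /q addrC subrK.
  have := sb q qs; rewrite qE fg fgy dfB [y + h - y]addrAC subrr add0r => H.
  have -> : q - h *m invmx B = - ((h - q *m B) *m invmx B).
    by rewrite mulmxBl mulmxK// opprB.
  rewrite normrN (le_trans (Bk _))// mulrC -ler_pdivlMr//.
  rewrite (le_trans H)// (le_trans (ler_wpM2l (ltW e'0) gL))//.
  by rewrite /e' le_eqVlt; apply/orP; left; apply/eqP; field; rewrite !gt_eqF.
split; first by case: dg.
by move=> v; rewrite deriveE; [rewrite diff_val|case: dg].
Qed.

Theorem inverse_function (R : realType) m (U : set 'rV[R]_m)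
    (f : 'rV[R]_m -> 'rV[R]_m) (x0 : 'rV[R]_m) :
  open U -> U x0 -> Ck_on 1 U f -> 'J f x0 \in unitmx ->
  exists (d : R) (g : 'rV[R]_m -> 'rV[R]_m),
    [/\ 0 < d,
        forall y, ball (f x0) d y -> U (g y) /\ f (g y) = y,
        g (f x0) = x0,
        \forall x \near x0, g (f x) = x
      & Ck_on 1 (ball (f x0) d) g].
Proof.
move=> oU Ux0 fC Ju.
have [r [K [[r0 K0] rU KJ KL rS]]] := inverse_function_setup oU Ux0 fC erefl Ju.
have df x : U x -> differentiable f x by move=> Ux; apply: fC.1; rewrite inE.
pose g y := xget x0 [set x | ball x0 (2 * r) x /\ f x = y].
pose d := r / K.
have d0 : 0 < d by rewrite divr_gt0.
have r20 : 0 < 2 * r by rewrite mulr_gt0.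
have gP y : ball (f x0) d y -> ball x0 (2 * r) (g y) /\ f (g y) = y.
  by move=> /rS ex; exact: (xgetPex x0 ex).
have gU y : ball (f x0) d y -> U (g y) by move=> /gP[/rU].
have gL y z : ball (f x0) d y -> ball (f x0) d z -> `|g y - g z| <= K * `|y - z|.
  move=> /gP[gy1 gy2] /gP[gz1 gz2].
  by have := KL _ _ gy1 gz1; rewrite gy2 gz2.
have gf x : ball x0 (2 * r) x -> ball (f x0) d (f x) -> g (f x) = x.
  move=> xr fx; have [g1 g2] := gP _ fx.
  apply/eqP; rewrite -subr_eq0 -normr_le0.
  by rewrite (le_trans (KL _ _ g1 xr))// g2 subrr normr0 mulr0.
have Bu y : ball (f x0) d y -> 'J f (g y) \in unitmx.
  by move=> /gP[gy _]; apply: (@unitmx_of_bound _ _ _ K) => v; exact: KJ.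
have dg y : ball (f x0) d y ->
    differentiable g y /\ forall v : 'rV[R]_m, 'D_v g y = v *m invmx ('J f (g y)).
  move=> yd.
  have yn : nbhs y (ball (f x0) d).
    by apply: open_nbhs_nbhs; split => //; exact: ball_open.
  have [s /= s0 sb] := (nbhs_ballP _ _).1 yn.
  have H z : ball y s z -> f (g z) = z /\ `|g z - g y| <= K * `|z - y|.
    by move=> /sb zd; split; [exact: (gP _ zd).2|exact: gL].
  have dfg : differentiable f (g y) by exact/df/gU.
  exact: (inverse_differential s0 K0 dfg erefl (Bu _ yd) H).
exists d, g; split.
- exact: d0.
- by move=> y yd; split; [exact: gU|exact: (gP _ yd).2].
- by apply: gf; exact: ballxx.
- have c : {for x0, continuous f} by exact/differentiable_continuous/df.
  near=> x; apply: gf; first by near: x; exact: nbhsx_ballx.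
  by near: x; apply: c; exact: nbhsx_ballx.
split=> [y|v y]; rewrite inE => yd; first by have [] := dg y yd.
have gc : {for y, continuous g}.
  by apply: differentiable_continuous; have [] := dg y yd.
pose w := 'D_v g y.
have cw : {for y, continuous (fun z => 'D_w f (g z))}.
  have cD : {for g y, continuous ('D_w f)}.
    by apply: fC.2; rewrite inE; exact: gU.
  exact: (continuous_comp gc cD).
have wJ z : ball (f x0) d z -> 'D_v g z *m 'J f (g z) = v.
  by move=> zd; rewrite ((dg z zd).2 v); exact: (mulmxKV (Bu z zd)).
apply/(@cvgrPdist_le _ _ _ (nbhs y)) => e e0.
have eK : 0 < e / K by rewrite divr_gt0.
have /(@cvgrPdist_le _ _ _ (nbhs y))/(_ _ eK) H := cw.
have yn : \forall z \near y, ball (f x0) d z.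
  by apply: open_nbhs_nbhs; split => //; exact: ball_open.
near=> z.
have zd : ball (f x0) d z by near: z.
have DwE u : ball (f x0) d u -> 'D_w f (g u) = w *m 'J f (g u).
  by move=> ud; exact: deriveEjacobian (df _ (gU _ ud)).
(* Multiplying by the Jacobian, which [KJ] bounds below, reduces the continuity of ['D_v g] to that
   of ['D_w f], so that no continuity of matrix inversion enters. *)
have E : (w - 'D_v g z) *m 'J f (g z) = 'D_w f (g z) - 'D_w f (g y).
  apply: etrans (mulmxBl _ _ _) _; congr (_ - _).
    by apply: esym; exact: DwE.
  exact: etrans (wJ z zd) (esym (etrans (DwE y yd) (wJ y yd))).
apply: le_trans (KJ _ _ (gP z zd).1) _.
rewrite E -ler_pdivlMl// mulrC distrC; near: z; exact: H.
Unshelve. all: by end_near. Qed.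

(** * Sections of a local homeomorphism *)

Section LocalSections.
Variables (R : realType) (V : normedModType R) (M : topologicalType).
Variables (X : M -> V).
Hypothesis hM : hausdorff_space M.

Definition local_inverse (p : M) (d : R) (i : V -> M) : Prop :=
  [/\ 0 < d,
      forall y, ball (X p) d y -> {for y, continuous i} /\ X (i y) = y,
      i (X p) = p
    & \forall q \near p, i (X q) = q].

Hypothesis locinv : forall p, exists d i, local_inverse p d i.

Definition section_near (s : V -> M) (y : V) : Prop :=
  {for y, continuous s} /\ \forall z \near y, X (s z) = z.

Lemma sections_agree_near (s1 s2 : V -> M) (y : V) :
  section_near s1 y -> section_near s2 y -> s1 y = s2 y ->
  \forall z \near y, s1 z = s2 z.
Proof.
move=> [c1 X1] [c2 X2] e12.
have [d [i [_ _ _ iX]]] := locinv (s1 y).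
have n1 : \forall z \near y, i (X (s1 z)) = s1 z by exact: (c1 _ iX).
have iX2 : nbhs (s2 y) [set q | i (X q) = q] by rewrite -e12.
have n2 : \forall z \near y, i (X (s2 z)) = s2 z by exact: (c2 _ iX2).
near=> z.
have <- : i (X (s1 z)) = s1 z by near: z.
have <- : i (X (s2 z)) = s2 z by near: z.
congr i; transitivity z; first by near: z.
by apply: esym; near: z.
Unshelve. all: by end_near. Qed.

Lemma disagree_near (T : topologicalType) (s1 s2 : T -> M) (y : T) :
  {for y, continuous s1} -> {for y, continuous s2} -> s1 y <> s2 y ->
  \forall z \near y, s1 z <> s2 z.
Proof.
move=> c1 c2 /eqP ne.
move: hM; rewrite open_hausdorff => /(_ _ _ ne) [] [A1 A2] /= [a1 a2].
move=> [A1o A2o A12].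
rewrite !inE in a1 a2.
have n1 : \forall z \near y, A1 (s1 z).
  by apply: (c1 A1); exact: open_nbhs_nbhs.
have n2 : \forall z \near y, A2 (s2 z).
  by apply: (c2 A2); exact: open_nbhs_nbhs.
near=> z => e.
have : (A1 `&` A2) (s1 z).
  by split; [near: z|rewrite e; near: z].
by rewrite (eqP A12).
Unshelve. all: by end_near. Qed.

(** Agreement is open by local uniqueness and disagreement is open by the Hausdorff property, so
    connectedness of the segment decides. The start [a] is arbitrary because gluing compares
    sections beyond points other than the origin. *)
Lemma sections_agree_on_ray (s1 s2 : V -> M) (y : V) (a b : R) :
  a <= b ->
  (forall t, a <= t <= b -> section_near s1 (t *: y)) ->
  (forall t, a <= t <= b -> section_near s2 (t *: y)) ->
  s1 (a *: y) = s2 (a *: y) -> s1 (b *: y) = s2 (b *: y).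
Proof.
move=> ab S1 S2 ea.
pose E := [set t : R | s1 (t *: y) = s2 (t *: y)].
pose N := [set t : R | s1 (t *: y) <> s2 (t *: y)].
have cy t : {for t, continuous (fun r : R => r *: y)}.
  exact: scalel_continuous.
have E1 t : `[a, b]%classic t -> E t -> E° t.
  rewrite /= in_itv/= => tab Et.
  exact: cy (sections_agree_near (S1 t tab) (S2 t tab) Et).
have N1 t : `[a, b]%classic t -> N t -> N° t.
  rewrite /= in_itv/= => tab Nt.
  have c1 := continuous_comp (cy t) (S1 t tab).1.
  have c2 := continuous_comp (cy t) (S2 t tab).1.
  exact: (disagree_near c1 c2 Nt).
suff : (`[a, b]%classic `&` E) = `[a, b]%classic.
  have bb : `[a, b]%classic b by rewrite /= in_itv/= lexx ab.
  by move/seteqP => [_ /(_ _ bb)[]].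
apply: (@segment_connected R a b).
- by exists a; split => //; rewrite /= in_itv/= lexx.
- exists E°; first exact: open_interior.
  apply/seteqP; split=> t [tab Et]; split => //; first exact: E1.
  exact: (@interior_subset _ E).
- exists (~` N°); first by apply: open_closedC; exact: open_interior.
  apply/seteqP; split=> t [tab Et]; split => //.
    by move=> /(@interior_subset _ N); apply.
  by apply: contrapT => /(N1 _ tab).
Qed.

End LocalSections.

Lemma near_eq_continuous (T T' : topologicalType) (f g : T -> T') (y : T) :
  (\forall z \near y, f z = g z) -> {for y, continuous g} ->
  {for y, continuous f}.
Proof.
move=> fg cg; rewrite /prop_for /continuous_at (nbhs_singleton fg) => B /cg gB.
by apply: (@filterS2 _ _ _ _ _ _ _ fg gB) => z /= ->.
Qed.

(** * Radial continuation to a global section *)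

Section GlobalSection.
Variables (R : realType) (V : normedModType R) (M : topologicalType).
Variables (X : M -> V) (p0 : M).
Hypothesis hM : hausdorff_space M.
Hypothesis X0 : X p0 = 0.
Hypothesis cX : continuous X.
Hypothesis locinv : forall p, exists d i, local_inverse X p d i.

(** Star-shapedness passes to intersections and joins every point to the origin, where all these
    sections take the value [p0]; this makes them unique and lets them be glued. *)
Definition starlike_section (D : set V) (s : V -> M) : Prop :=
  [/\ open D, D 0,
      forall y t, D y -> 0 <= t <= 1 -> D (t *: y),
      forall y, D y -> {for y, continuous s} /\ X (s y) = y
    & s 0 = p0].

(** Completeness enters the topological argument through this hypothesis alone. *)
Hypothesis radial_limit : forall D s v, starlike_section D s ->
  (forall t, 0 <= t < 1 -> D (t *: v)) ->
  exists p : M, s ((1 - n.+1%:R^-1) *: v) @[n --> \oo] --> p.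

Lemma starlike_section_near D s y :
  starlike_section D s -> D y -> section_near X s y.
Proof.
move=> [oD D0 Dstar Ds s0] Dy; split; first by have [] := Ds y Dy.
have : nbhs y D by exact: open_nbhs_nbhs.
by apply: filterS => z /Ds[].
Qed.

Lemma local_inverse_near p d i y :
  local_inverse X p d i -> ball (X p) d y -> section_near X i y.
Proof.
move=> [d0 ib _ _] yb; split; first by have [] := ib y yb.
have : nbhs y (ball (X p) d) by apply: open_nbhs_nbhs; split=> //; exact: ball_open.
by apply: filterS => z /ib[].
Qed.

Lemma starlike_section_unique D1 s1 D2 s2 y :
  starlike_section D1 s1 -> starlike_section D2 s2 -> D1 y -> D2 y ->
  s1 y = s2 y.
Proof.
move=> S1 S2 D1y D2y; rewrite -[y]scale1r.
have [_ _ D1star _ s10] := S1; have [_ _ D2star _ s20] := S2.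
apply: (sections_agree_on_ray hM locinv (a := 0)) => //.
- by move=> t t01; exact: starlike_section_near S1 (D1star _ _ D1y t01).
- by move=> t t01; exact: starlike_section_near S2 (D2star _ _ D2y t01).
- by rewrite scale0r s10 s20.
Qed.

(** A local inverse at the limit point over [v] prolongs [s] beyond [v]; the delicate point is to
    glue the two over a domain that is still star-shaped. *)
Lemma starlike_section_extend D s v : starlike_section D s ->
  (forall t, 0 <= t < 1 -> D (t *: v)) ->
  exists D' s', starlike_section D' s' /\ D' v.
Proof.
move=> S Dv; have [oD D0 Dstar Ds s0] := S.
have [p plim] := radial_limit S Dv.
pose tn (n : nat) : R := 1 - n.+1%:R^-1.
have tn01 n : 0 <= tn n < 1.
  by rewrite subr_ge0 invf_le1// ler1n ltrBlDr ltrDl invr_gt0 ltr0n.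
have tnlim : tn n *: v @[n --> \oo] --> v.
  have tn1 : tn n @[n --> \oo] --> (1 : R).
    rewrite -[X in _ --> X]subr0; apply: cvgB; first exact: cvg_cst.
    exact: cvg_harmonic.
  have := cvg_comp _ _ tn1 (@scalel_continuous _ _ v 1).
  by rewrite scale1r.
have Xpv : X p = v.
  have h : X (s (tn n *: v)) @[n --> \oo] --> X p.
    exact: (cvg_comp _ _ plim (@cX p)).
  have h' : (fun n => X (s (tn n *: v))) = (fun n => tn n *: v).
    by apply/funext => n; have [] := Ds _ (Dv _ (tn01 n)).
  rewrite h' in h.
  exact: (cvg_unique (@norm_hausdorff _ V) h tnlim).
have [d [i LI]] := locinv p; have [d0 ib ip ip'] := LI.
rewrite Xpv in ib ip.
(* For large [n] the point [tn n *: v] is in the ball and its image under [s] is where [i] undoes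
   [X]. *)
have [n [nb ni]] : exists n, ball v d (tn n *: v) /\
    i (tn n *: v) = s (tn n *: v).
  have h1 : \forall n \near \oo, ball v d (tn n *: v).
    by apply: tnlim; exact: nbhsx_ballx.
  have h2 : \forall n \near \oo, i (X (s (tn n *: v))) = s (tn n *: v).
    exact: plim _ ip'.
  have [n [nb ni]] := filter_ex (filterI h1 h2).
  exists n; split; first exact: nb.
  by rewrite -[RHS]ni (Ds _ (Dv _ (tn01 n))).2.
pose t0 := tn n; have /andP[t00 t01] := tn01 n.
have Dt0 : D (t0 *: v) by exact: (Dv _ (tn01 n)).
(* [s] and [i] agree on [W]; they also agree on [C `&` D], because a point of
   [C `&` D] is joined radially to a point of [W] within both domains. *)
pose W := D `&` ball v d `&` [set u | s u = i u]°.
have oW : open W.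
  apply: openI; last exact: open_interior.
  by apply: openI => //; exact: ball_open.
have Wt0 : W (t0 *: v).
  split; first by split.
  apply: (sections_agree_near locinv) => //.
  - exact: starlike_section_near S Dt0.
  - by apply: local_inverse_near LI _; rewrite Xpv.
have Wsi u : W u -> s u = i u.
  by move=> [_ /(@interior_subset _ [set u | s u = i u])].
pose C := ball v d `&` \bigcup_(t in [set t : R | 0 <= t <= 1])
  ((fun y => t *: y) @^-1` W).
have oC : open C.
  apply: openI; first exact: ball_open.
  apply: bigcup_open => t _; apply: open_comp => // y _.
  exact: scaler_continuous.
(* Convexity of the ball, which contains both [t *: y] and [y]; [t = 1] is set apart as a zero
   denominator. *)
have Cseg y t t' : ball v d y -> W (t *: y) -> t <= t' <= 1 ->
    ball v d (t' *: y).
  move=> yb [[_ tb] _] /andP[tt' t'1].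
  have [t1|t1] := eqVneq t 1.
    have -> : t' = 1 by apply/eqP; rewrite eq_le t'1 -t1 tt'.
    by rewrite scale1r.
  have tlt1 : 0 < 1 - t by rewrite subr_gt0 lt_neqAle t1 (le_trans tt').
  have -> : t' *: y = t *: y + ((t' - t) / (1 - t)) *: (y - t *: y).
    rewrite -[X in _ *: (X - _)]scale1r -scalerBl scalerA divfK ?gt_eqF//.
    by rewrite -scalerDl addrC subrK.
  apply: ball_segment => //; rewrite divr_ge0 ?subr_ge0// ?(ltW tlt1)//=.
    by rewrite ler_pdivrMr// mul1r lerB.
  by move: tlt1; rewrite subr_gt0 => /ltW.
have Csi y : C y -> D y -> s y = i y.
  move=> [yb [t /= /andP[tge0 tle1] Wty]] Dy; rewrite -[y]scale1r.
  apply: (sections_agree_on_ray hM locinv (a := t)) => //.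
  - move=> t' /andP[tt' t'1]; apply: starlike_section_near S _.
    by apply: Dstar => //; rewrite t'1 (le_trans tge0).
  - move=> t' tt'; apply: local_inverse_near LI _; rewrite Xpv.
    exact: Cseg yb Wty tt'.
  - exact: Wsi.
pose D' := D `|` C.
pose s' y := if pselect (D y) then s y else i y.
have s'D y : D y -> s' y = s y by rewrite /s'; case: pselect.
have s'C y : C y -> s' y = i y.
  by rewrite /s'; case: pselect => // Dy Cy; exact: Csi.
exists D', s'; split; last first.
  right; split; first exact: ballxx.
  by exists t0; rewrite /= ?t00 ?ltW.
split.
- exact: openU.
- by left.
- move=> y t [Dy|[yb [t' /= t'01 Wt'y]]] /andP[tge0 tle1].
    by left; apply: Dstar => //; rewrite tge0.
  (* Beyond its point in [W] the ray stays in [C], with the new witness [t' / t]; before that point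
     it lies in [D], which is star-shaped. *)
  have [tt'|/ltW tt'] := leP t' t.
    have [t0'|tn0] := eqVneq t 0; first by left; rewrite t0' scale0r.
    have tgt0 : 0 < t by rewrite lt_neqAle eq_sym tn0.
    right; split; first by apply: Cseg yb Wt'y _; rewrite tt'.
    exists (t' / t) => /=.
      have /andP[t'0 _] := t'01.
      by rewrite divr_ge0//= ler_pdivrMr// mul1r.
    by rewrite scalerA divfK.
  have [t'0|t'n0] := eqVneq t' 0.
    left; have -> : t = 0 by apply/eqP; rewrite eq_le tge0 andbT -t'0.
    by rewrite scale0r.
  left; have -> : t *: y = (t / t') *: (t' *: y) by rewrite scalerA divfK.
  apply: Dstar; first by have [[]] := Wt'y.
  have /andP[t'0 _] := t'01.
  by rewrite divr_ge0//= ler_pdivrMr ?mul1r// lt_neqAle eq_sym t'n0.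
- move=> y [Dy|Cy].
    have [cs Xs] := Ds y Dy; rewrite (s'D y Dy); split => //.
    apply: (near_eq_continuous (g := s)) => //.
    have : nbhs y D by exact: open_nbhs_nbhs.
    by apply: filterS => z /s'D.
  have [ci Xi] := ib y Cy.1; rewrite (s'C y Cy); split => //.
  apply: (near_eq_continuous (g := i)) => //.
  have : nbhs y C by exact: open_nbhs_nbhs.
  by apply: filterS => z /s'C.
- by rewrite s'D.
Qed.

(** By uniqueness all starlike sections extend to the union [D] of their domains, and the result is
    again one of them. Along each ray [D] is open, and closed by the extension lemma. *)
Lemma exists_global_section :
  exists s, [/\ forall y, {for y, continuous s}, forall y, X (s y) = y
               & s 0 = p0].
Proof.
pose D := [set y | exists D' s', starlike_section D' s' /\ D' y].
pose s y := xget p0 [set q | exists D' s',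
  [/\ starlike_section D' s', D' y & s' y = q]].
have sE D' s' y : starlike_section D' s' -> D' y -> s y = s' y.
  move=> S' D'y; have : exists q, [set q | exists D' s',
      [/\ starlike_section D' s', D' y & s' y = q]] q.
    by exists (s' y), D', s'.
  move=> /(xgetPex p0)[D1 [s1 [S1 D1y]]]; rewrite -/(s y) => <-.
  exact: (starlike_section_unique S1 S').
have [d [i LI]] := locinv p0; have [d0 ib ip ip'] := LI.
have S0 : starlike_section (ball 0 d) i.
  rewrite X0 in ib ip; split => //.
  - exact: ball_open.
  - exact: ballxx.
  - move=> y t yd t01; have := ball_segment yd (ballxx 0 d0) t01.
    by rewrite add0r subr0.
have near_s D' s' y : starlike_section D' s' -> D' y ->
    \forall z \near y, s z = s' z.
  move=> S' D'y; have [oD' _ _ _ _] := S'.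
  have : nbhs y D' by exact: open_nbhs_nbhs.
  by apply: filterS => z; exact: sE.
have S : starlike_section D s.
  split.
  - rewrite openE => y [D' [s' [S' D'y]]]; have [oD' _ _ _ _] := S'.
    have : nbhs y D' by exact: open_nbhs_nbhs.
    by apply: filterS => z D'z; exists D', s'.
  - by exists (ball 0 d), i; split => //; exact: ballxx.
  - move=> y t [D' [s' [S' D'y]]] t01; exists D', s'; split => //.
    by have [_ _ + _ _] := S'; apply.
  - move=> y [D' [s' [S' D'y]]]; have [_ _ _ Ds' _] := S'.
    have [cs' Xs'] := Ds' y D'y.
    rewrite (sE _ _ _ S' D'y); split => //.
    exact: near_eq_continuous (near_s _ _ _ S' D'y) cs'.
  - by rewrite (sE _ _ _ S0 (ballxx 0 d0)); have [] := S0.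
have [oD D0 Dstar Ds s0] := S.
have ext v : (forall t, 0 <= t < 1 -> D (t *: v)) -> D v.
  by move=> /(starlike_section_extend S)[D' [s' [S' D'v]]]; exists D', s'.
have DT y : D y.
  pose E := [set t : R | 0 <= t <= 1 /\ D (t *: y)].
  have E0 : E 0 by split; rewrite ?lexx ?ler01// scale0r.
  have Eub : ubound E 1 by move=> t [/andP[]].
  have hE : has_sup E by split; [exists 0|exists 1].
  pose u := sup E.
  have u0 : 0 <= u by apply: sup_upper_bound.
  have u1 : u <= 1 by apply: sup_le_ub; [exists 0|].
  (* Below the supremum the whole ray lies in [D], so [ext] applies at [u *: y] itself. *)
  have Du : D (u *: y).
    apply: ext => t /andP[t0 t1]; rewrite scalerA.
    have [->|un0] := eqVneq u 0; first by rewrite mulr0 scale0r.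
    have ugt0 : 0 < u by rewrite lt_neqAle eq_sym un0.
    have tu : 0 < u - t * u by rewrite subr_gt0 gtr_pMl.
    have [r [/andP[r0 r1] Dr] rt] := sup_adherent tu hE.
    rewrite opprB addrC subrK in rt.
    have rgt0 : 0 < r by rewrite (le_lt_trans _ rt)// mulr_ge0.
    have -> : (t * u) *: y = (t * u / r) *: (r *: y).
      by rewrite scalerA divfK// gt_eqF.
    apply: Dstar => //; rewrite divr_ge0 ?mulr_ge0//=.
    by rewrite ler_pdivrMr// mul1r ltW.
  have [u1e|un1] := eqVneq u 1; first by rewrite u1e scale1r in Du.
  have ult1 : u < 1 by rewrite lt_neqAle un1.
  have : \forall t \near u, D (t *: y).
    have c : {for u, continuous (fun r : R => r *: y)} by exact: scalel_continuous.
    by apply: (c D); exact: open_nbhs_nbhs.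
  move=> [e /= e0 eD].
  (* A step beyond [u], short enough for [eD] and capped so that [t <= 1]; it contradicts the
     supremum. *)
  pose t := u + Num.min (e / 2) (1 - u).
  have m0 : 0 < Num.min (e / 2) (1 - u) by rewrite lt_min divr_gt0// subr_gt0.
  have Et : E t.
    split; first by rewrite addr_ge0 ?(ltW m0)//= -lerBrDl ge_min lexx orbT.
    apply: eD; rewrite /= opprD addNKr normrN gtr0_norm//.
    by rewrite gt_min ltr_pdivrMr// ltr_pMr// ltr1n.
  have := sup_upper_bound hE Et; rewrite -/u /t gerDl.
  by rewrite leNgt m0.
by exists s; split=> [y|y|]; [exact: (Ds y (DT y)).1|exact: (Ds y (DT y)).2|].
Qed.

End GlobalSection.

(** * C^1 maps, charts and local inverses of the projection *)

Section C1Maps.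
Variable R : realType.

Lemma continuous_sumE (T : topologicalType) (W : normedModType R) n
    (f : 'I_n -> T -> W) (y : T) :
  (forall i, {for y, continuous (f i)}) ->
  {for y, continuous (fun z => \sum_i f i z)}.
Proof.
move=> cf; apply: cvg_big => [|i _]; first exact: add_continuous.
exact: cf.
Qed.

Lemma near_eq_differentiable (V W : normedModType R) (f g : V -> W) (y : V) :
  (\forall z \near y, f z = g z) -> differentiable g y -> differentiable f y.
Proof.
move=> fg dg; have cdg : continuous ('d g y) by exact: diff_continuous.
suff : is_diff y f ('d g y) by case.
apply: eps_differentiable => // e e0.
have fg0 : \forall h \near (0 : V), f (y + h) = g (y + h).
  have c : {for (0 : V), continuous (fun h => y + h)}.
    by apply: continuousD; [exact: cst_continuous|exact: cvg_id].
  have fgy : nbhs (y + 0) [set z | f z = g z] by rewrite addr0.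
  exact: c _ fgy.
apply: filterS2 fg0 (differentiable_eps dg e0) => h ->.
by rewrite (nbhs_singleton fg).
Qed.

Lemma Ck1_near (V W : normedModType R) (U : set V) (f : V -> W) :
  (forall y, U y -> exists g S,
    [/\ Ck_on 1 S g, S y & \forall z \near y, f z = g z]) -> Ck_on 1 U f.
Proof.
move=> H; split=> [y|v y]; rewrite inE => /H[g [S [gC Sy fg]]].
  by apply: near_eq_differentiable fg _; apply: gC.1; rewrite inE.
apply: near_eq_continuous (gC.2 v y _); last by rewrite inE.
have := nbhs_interior fg; apply: filterS => z fgz.
exact: near_eq_derive.
Qed.

(** In the chain rule the direction ['D_v g z] varies with [z], whereas [Ck_on] speaks of fixed
    directions; expanding it in the canonical basis bridges the gap. *)
Lemma Ck1_comp (V W : normedModType R) m (U : set V) (S : set 'rV[R]_m)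
    (g : V -> 'rV[R]_m) (h : 'rV[R]_m -> W) :
  open U -> Ck_on 1 U g -> Ck_on 1 S h -> (forall y, U y -> S (g y)) ->
  Ck_on 1 U (h \o g).
Proof.
move=> oU gC hC US.
have dg y : U y -> differentiable g y by move=> Uy; apply: gC.1; rewrite inE.
have dh y : U y -> differentiable h (g y).
  by move=> /US Sy; apply: hC.1; rewrite inE.
have dhg y : U y -> differentiable (h \o g) y.
  by move=> Uy; apply: differentiable_comp; [exact: dg|exact: dh].
split=> [y|v y]; rewrite inE => Uy; first exact: dhg.
have DE z : U z -> 'D_v (h \o g) z =
    \sum_i ('D_v g z) 0 i *: 'D_(delta_mx (0 : 'I_1) i) h (g z).
  move=> Uz; rewrite (deriveE _ (dhg _ Uz)) diff_comp; [|exact: dg|exact: dh].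
  rewrite /= -(deriveE _ (dg _ Uz)) {1}[X in 'd h _ X]row_sum_delta linear_sum.
  by apply: eq_bigr => i _; rewrite linearZ/= (deriveE _ (dh _ Uz)).
apply: near_eq_continuous.
  have : nbhs y U by exact: open_nbhs_nbhs.
  by apply: filterS => z; exact: DE.
have cg : {for y, continuous g} by exact/differentiable_continuous/dg.
have cDg : {for y, continuous ('D_v g)} by apply: gC.2; rewrite inE.
have cD i : {for y, continuous (fun z => 'D_(delta_mx (0 : 'I_1) i) h (g z))}.
  have cDh : {for g y, continuous ('D_(delta_mx (0 : 'I_1) i) h)}.
    by apply: hC.2; rewrite inE; exact: US.
  exact: (continuous_comp cg cDh).
have ci i : {for y, continuous (fun z => ('D_v g z) 0 i : R)}.
  have cc := differentiable_continuous (differentiable_coord ('D_v g y) 0 i).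
  exact: (continuous_comp cDg cc).
apply: continuous_sumE => i.
exact: cvgZ (ci i) (cD i).
Qed.

Lemma Ck1_affine m n (P : 'M[R]_(m, n)) (b : 'rV[R]_n) :
  Ck_on 1 [set: 'rV[R]_m] (fun u => u *m P - b) /\
  forall v x, 'D_v (fun u : 'rV[R]_m => u *m P - b) x = v *m P.
Proof.
have cP : continuous (mulmxr P : 'rV[R]_m -> _) by exact: mulmxr_continuous.
have dP x : differentiable (mulmxr P : 'rV[R]_m -> 'rV[R]_n) x.
  exact: linear_differentiable.
have db x : differentiable (fun u : 'rV[R]_m => u *m P - b) x.
  exact: differentiableB.
have DE v x : 'D_v (fun u : 'rV[R]_m => u *m P - b) x = v *m P.
  have e1 : 'D_v (mulmxr P : 'rV[R]_m -> 'rV[R]_n) x = v *m P.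
    by rewrite deriveE// diff_lin.
  have := @deriveB _ _ _ (mulmxr P : 'rV[R]_m -> 'rV[R]_n) (cst b) x v
    (diff_derivable (dP x)) (derivable_cst _ _ _).
  by rewrite derive_cst subr0 e1.
split => //; split=> [x _|v x _]; first exact: db.
have -> : 'D_v (fun u : 'rV[R]_m => u *m P - b) = cst (v *m P).
  by apply/funext => z; rewrite DE.
exact: cst_continuous.
Qed.

Lemma Ck1_line m (v : 'rV[R]_m) (c d : R) :
  Ck_on 1 [set: R] (fun t : R => (c + t * d) *: v) /\
  forall t : R, is_derive t 1 (fun t : R => (c + t * d) *: v) (d *: v).
Proof.
have dl (t : R) : is_derive t 1 (fun t : R => (c + t * d) *: v) (d *: v).
  have := @is_derive_line R _ _ id (c *: v) (d *: v) t.
  rewrite derive_id (_ : (fun r : R => id _) = fun r : R => (c + r * d) *: v).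
    by apply; exact: ex_diff.
  by apply/funext => r /=; rewrite scalerA -scalerDl.
have df (t : R) : differentiable (fun t : R => (c + t * d) *: v) t.
  by apply/derivable1_diffP; case: (dl t).
split => //; split=> [t _|w t _]; first exact: df.
have -> : 'D_w (fun t : R => (c + t * d) *: v) = cst (w *: (d *: v)).
  apply/funext => r; rewrite deriveE// -[w in LHS]mulr1 [LHS]linearZ/=.
  by rewrite -deriveE//; case: (dl r) => _ ->.
exact: cst_continuous.
Qed.

Lemma spatial_derivative m n (f : 'rV[R]_m -> 'rV[R]_n) (P : 'M[R]_(n, m))
    (b : 'rV[R]_m) (U : set 'rV[R]_m) :
  open U -> Ck_on 1 U f ->
  Ck_on 1 U (fun x => f x *m P - b) /\
  forall x, U x -> 'J (fun x => f x *m P - b) x = 'J f x *m P.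
Proof.
move=> oU fC; have [aC aD] := Ck1_affine P b.
have gC : Ck_on 1 U (fun x => f x *m P - b).
  exact: (Ck1_comp oU fC aC).
split => // x Ux.
have df : differentiable f x by apply: fC.1; rewrite inE.
have dg : differentiable (fun x => f x *m P - b) x by apply: gC.1; rewrite inE.
have da : differentiable (fun u : 'rV[R]_n => u *m P - b) (f x).
  by apply: aC.1; rewrite inE.
apply/row_matrixP => i; rewrite row_mul !rowE.
rewrite -(deriveEjacobian _ dg) -(deriveEjacobian _ df) -(aD _ (f x)).
rewrite (deriveE _ dg) (deriveE _ da) (deriveE _ df).
by rewrite (diff_comp df da).
Qed.

End C1Maps.

Section ChartsAndSections.
Variables (R : realType) (m : nat) (M : topologicalType).
Variable A : set (chart R m M).

(** Same form as the chart condition in [C1_curve_on], so that lifted segments qualify as curves for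
    the distance. *)
Definition C1_into (V : normedModType R) (U : set V) (s : V -> M) : Prop :=
  forall c, A c -> Ck_on 1 (U `&` s @^-1` cdom c) (cmap c \o s).

Hypothesis hA : smooth_atlas A.

Lemma chart_at (p : M) : exists2 c, A c & cdom c p.
Proof. by have [/seteqP[_ /(_ p I)] [c Ac cp]] := hA; exists c. Qed.

(** The inverse function theorem in the chart [c] gives [g], and [cinv c \o g] inverts [X]; read in
    another chart it is [g] followed by a smooth transition map. *)
Lemma local_inverse_chart (X : M -> 'rV[R]_m) (c : chart R m M) (p : M) :
  A c -> cdom c p -> Ck_on 1 (cimg c) (X \o cinv c) ->
  'J (X \o cinv c) (cmap c p) \in unitmx ->
  exists d i, local_inverse X p d i /\ C1_into (ball (X p) d) i.
Proof.
move=> Ac cp; set f := X \o cinv c => fC Ju.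
have xU : cimg c (cmap c p) by exists p.
have ck q : cdom c q -> cinv c (cmap c q) = q.
  by move=> cq; apply: cmapK; rewrite inE.
have [d [g [d0 gU gx gn gC]]] := inverse_function (cimg_open (c := c)) xU fC Ju.
have fx : f (cmap c p) = X p by rewrite /f/= ck.
rewrite fx in gU gx gC.
have dg y : ball (X p) d y -> differentiable g y.
  by move=> yb; apply: gC.1; rewrite inE.
have cg y : ball (X p) d y -> {for y, continuous g}.
  by move=> yb; apply: differentiable_continuous; exact: dg.
have ci y : ball (X p) d y -> {for y, continuous (cinv c \o g)}.
  move=> yb; apply: continuous_comp; first exact: cg.
  by apply: cinv_continuous; rewrite inE; exact: (gU _ yb).1.
exists d, (cinv c \o g); split; first split => //.
- by move=> y yb; split; [exact: ci|exact: (gU _ yb).2].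
- by rewrite /= gx ck.
- have cc : {for p, continuous (cmap c)} by apply: cmap_continuous; rewrite inE.
  have n1 : \forall q \near p, g (f (cmap c q)) = cmap c q by exact: cc _ gn.
  have n2 : \forall q \near p, cdom c q.
    by apply: open_nbhs_nbhs; split => //; exact: cdom_open.
  apply: filterS2 n1 n2 => q q1 q2.
  by rewrite /= -{1}(ck q q2) -/(f _) q1 ck.
move=> c' Ac'.
have [_ smooth] := hA.
have hC := smooth c c' Ac Ac' 1%N.
rewrite -[cmap c' \o (cinv c \o g)]/((cmap c' \o cinv c) \o g).
apply: Ck1_comp hC _.
- rewrite openE => y [yb yc].
  have n1 : nbhs y (ball (X p) d).
    by apply: open_nbhs_nbhs; split => //; exact: ball_open.
  have n2 : nbhs y ((cinv c \o g) @^-1` cdom c').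
    by apply: (ci _ yb); apply: open_nbhs_nbhs; split => //; exact: cdom_open.
  by apply: filterS2 n1 n2 => z z1 z2; split.
- split=> [y|v y]; rewrite inE => -[yb _]; first exact: dg.
  by apply: gC.2; rewrite inE.
- move=> y [yb /= yc]; have [[q cq qe] _] := gU _ yb.
  by exists q => //; split => //; move: yc; rewrite -qe ck.
Qed.

(** A continuous section agrees locally with a local inverse and inherits its regularity. *)
Lemma section_C1_into (X : M -> 'rV[R]_m) (U : set 'rV[R]_m)
    (s : 'rV[R]_m -> M) :
  (forall p, exists d i, local_inverse X p d i /\ C1_into (ball (X p) d) i) ->
  (forall y, U y -> section_near X s y) -> C1_into U s.
Proof.
move=> locinv sU c Ac; apply: Ck1_near => y [Uy yc].
have locinv' p : exists d i, local_inverse X p d i.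
  by have [d [i [LI _]]] := locinv p; exists d, i.
have [d [i [LI iC]]] := locinv (s y); have [d0 ib ip _] := LI.
have Xsy : X (s y) = y by have [_ /nbhs_singleton] := sU y Uy.
have yb : ball (X (s y)) d y by rewrite -{2}Xsy; exact: ballxx.
have iy : i y = s y by rewrite -{1}Xsy.
exists (cmap c \o i), (ball (X (s y)) d `&` i @^-1` cdom c).
split; [exact: iC|by split; rewrite /= ?iy|].
have := sections_agree_near locinv' (sU y Uy) (local_inverse_near LI yb)
  (esym iy).
by apply: filterS => z /= ->.
Qed.

End ChartsAndSections.

(** * The projection of a spacelike hypersurface to the fibre *)

Section SpacelikeProjection.
Variables (R : realType) (m : nat) (M : topologicalType).
Variables (A : set (chart R m M)) (a : R).
Hypothesis a0 : 0 < a.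
Local Notation G := (@rw_metric R m (radiation_warping a)).
Variables (psi : M -> 'rV[R]_m.+1).
Hypothesis hA : smooth_atlas A.
Hypothesis hpsi : spacelike_hypersurface A G psi.

Definition space_mx : 'M[R]_(m.+1, m) := \matrix_(j, i) (j == lift 0 i)%:R.

Lemma mul_space_mx (u : 'rV[R]_m.+1) i : (u *m space_mx) 0 i = u 0 (lift 0 i).
Proof.
rewrite mxE (bigD1 (lift 0 i))//= big1 ?addr0; first by rewrite mxE eqxx mulr1.
by move=> j ji; rewrite mxE (negbTE ji) mulr0.
Qed.

(** The translation by [b] serves to place a chosen point over the origin, from which the rays
    start. *)
Definition space_part (b : 'rV[R]_m) (p : M) : 'rV[R]_m := psi p *m space_mx - b.

Lemma psi_Ck (c : chart R m M) k : A c -> Ck_on k (cimg c) (psi \o cinv c).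
Proof. by have [_ [psiC _] _] := hpsi; move=> /psiC. Qed.

Lemma induced_inner c x (v : 'rV[R]_m) :
  inner (induced_metric G psi c) x v v =
  inner G (psi (cinv c x)) (v *m 'J (psi \o cinv c) x) (v *m 'J (psi \o cinv c) x).
Proof.
rewrite /inner /induced_metric; move: ('J _ _) => J.
by rewrite trmx_mul !mulmxA.
Qed.

(** A tangent vector killed by the projection points in the time direction, where the metric is not
    positive; a spacelike tangent space contains no such vector but 0. *)
Lemma space_part_unit b (c : chart R m M) x : A c -> cimg c x ->
  'J (space_part b \o cinv c) x \in unitmx.
Proof.
move=> Ac xU; have [psi0 _ /(_ c Ac x xU) riem] := hpsi.
have [_ /(_ x xU) JE] := spatial_derivative space_mx b (cimg_open (c := c)) (psi_Ck 1 Ac).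
have -> : 'J (space_part b \o cinv c) x = 'J (psi \o cinv c) x *m space_mx.
  exact: JE.
rewrite -row_free_unit -kermx_eq0; apply/eqP/row_matrixP => i.
rewrite row0; apply/eqP; apply: contraT => v0.
have := riem _ v0; rewrite induced_inner.
have : row i (kermx ('J (psi \o cinv c) x *m space_mx)) *m
    ('J (psi \o cinv c) x *m space_mx) = 0 by rewrite -row_mul mulmx_ker row0.
move: ('J _ _) v0 => J; move: (row i _) => v v0; rewrite mulmxA => vJ.
rewrite radiation_innerE//; last exact: psi0.
have -> : sdot (v *m J) (v *m J) = 0.
  by rewrite /sdot big1// => k _; rewrite -mul_space_mx vJ mxE mul0r.
by rewrite mulr0 addr0 oppr_gt0 -expr2 ltNge sqr_ge0.
Qed.

Lemma psi_continuous : continuous psi.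
Proof.
move=> p; have [c Ac cp] := chart_at hA p.
have ck q : cdom c q -> cinv c (cmap c q) = q.
  by move=> cq; apply: cmapK; rewrite inE.
have cc : {for p, continuous (cmap c)} by apply: cmap_continuous; rewrite inE.
have cpsi : {for cmap c p, continuous (psi \o cinv c)}.
  by apply: (psi_Ck 0 Ac); rewrite inE; exists p.
have := continuous_comp cc cpsi.
apply: near_eq_continuous.
have n2 : \forall q \near p, cdom c q.
  by apply: open_nbhs_nbhs; split => //; exact: cdom_open.
by apply: filterS n2 => q cq; rewrite /= ck.
Qed.

Lemma space_part_continuous b : continuous (space_part b).
Proof.
have [aC _] := Ck1_affine space_mx b.
move=> p; have ca : {for psi p, continuous (fun u : 'rV[R]_m.+1 => u *m space_mx - b)}.
  by apply: differentiable_continuous; apply: aC.1; rewrite inE.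
exact: (continuous_comp (@psi_continuous p) ca).
Qed.

Lemma space_part_local_inverse b p : exists d i,
  local_inverse (space_part b) p d i /\
  C1_into A (ball (space_part b p) d) i.
Proof.
have [c Ac cp] := chart_at hA p.
apply: (local_inverse_chart hA Ac cp).
  by have [] := spatial_derivative space_mx b (cimg_open (c := c)) (psi_Ck 1 Ac).
by apply: space_part_unit => //; exists p.
Qed.

End SpacelikeProjection.

(** * Lengths of lifted segments *)

(* The integral of a nonnegative function is by definition a supremum over the
   simple functions below it, so monotonicity does not involve measurability. *)
Lemma ge0_le_integral_nomeas (d : measure_display) (T : measurableType d) (R : realType)
    (mu : {measure set T -> \bar R}) (D : set T) (f g : T -> \bar R) :
  (forall x, D x -> (0 <= f x)%E) -> (forall x, D x -> (f x <= g x)%E) ->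
  (\int[mu]_(x in D) f x <= \int[mu]_(x in D) g x)%E.
Proof.
move=> f0 fg; rewrite !ge0_integralE//; last first.
  by move=> x Dx; exact: le_trans (f0 x Dx) (fg x Dx).
apply: le_ereal_sup => _ [h hf <-]; exists h => // x.
apply: le_trans (hf x) _; rewrite !patchE; case: ifPn => //.
by rewrite inE; exact: fg.
Qed.

Lemma integral_unit_interval_le (R : realType) (f : R -> R) (c : R) :
  0 <= c -> (forall t, t \in `[0, 1]%R -> 0 <= f t <= c) ->
  (\int[lebesgue_measure]_(t in `[0%R, 1%R]) (f t)%:E <= c%:E)%E.
Proof.
move=> c0 fc.
apply: le_trans (ge0_le_integral_nomeas (g := cst c%:E) _ _ _) _.
- by move=> t /fc/andP[? _]; rewrite lee_fin.
- by move=> t /fc/andP[_ ?]; rewrite lee_fin.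
rewrite integral_cst//= lebesgue_measure_itv/= lte_fin ltr01 oppr0 addr0.
by rewrite mule1.
Qed.

Section RadialLimits.
Variables (R : realType) (m : nat) (M : topologicalType).
Variables (A : set (chart R m M)) (a : R).
Hypothesis a0 : 0 < a.
Local Notation G := (@rw_metric R m (radiation_warping a)).
Variables (psi : M -> 'rV[R]_m.+1) (tmax : R) (b : 'rV[R]_m).
Hypothesis hA : smooth_atlas A.
Hypothesis hpsi : spacelike_hypersurface A G psi.
Hypothesis htmax : forall p, psi p 0 0 <= tmax.
Local Notation X := (space_part psi b).

Section Segment.
Variables (U : set 'rV[R]_m) (s : 'rV[R]_m -> M) (v : 'rV[R]_m) (al be : R).
Hypothesis oU : open U.
Hypothesis sU : forall y, U y -> section_near X s y.
(** Affine in [t], because the curves that define the distance are parametrized by the unit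
    interval. *)
Let l (t : R) : 'rV[R]_m := (al + t * be) *: v.
Hypothesis lU : forall t, t \in `[0, 1]%R -> U (l t).

Let Ul := l @^-1` U.

Let oUl : open Ul.
Proof.
apply: open_comp => // t _; apply: differentiable_continuous.
by apply: (Ck1_line v al be).1.1; rewrite inE.
Qed.

Let sC : C1_into A U s.
Proof. exact: section_C1_into (space_part_local_inverse a0 hA hpsi b) sU. Qed.

Let cs t : Ul t -> {for t, continuous (s \o l)}.
Proof.
move=> Ut; apply: continuous_comp; last by have [] := sU Ut.
apply: differentiable_continuous.
by apply: (Ck1_line v al be).1.1; rewrite inE.
Qed.

Lemma open_segment_chart (c : chart R m M) :
  open (Ul `&` (s \o l) @^-1` cdom c).
Proof.
rewrite openE => t [Ut tc].
have n1 : nbhs t Ul by exact: open_nbhs_nbhs.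
have n2 : nbhs t ((s \o l) @^-1` cdom c).
  by apply: (cs Ut); apply: open_nbhs_nbhs; split => //; exact: cdom_open.
by apply: filterS2 n1 n2 => z z1 z2; split.
Qed.

Lemma segment_C1 : C1_into A Ul (s \o l).
Proof.
move=> c Ac; rewrite -[cmap c \o (s \o l)]/((cmap c \o s) \o l).
apply: (Ck1_comp (open_segment_chart (c := c)) _ (sC Ac)) => //.
split=> [t _|w t _]; first by apply: (Ck1_line v al be).1.1; rewrite inE.
by apply: (Ck1_line v al be).1.2; rewrite inE.
Qed.

Lemma segment_piecewise_C1 : piecewise_C1_curve A (s \o l).
Proof.
exists 1%N, (fun k => k%:R); split => // k; rewrite ltnS leqn0 => /eqP ->.
split; first exact: ltr01.
exists (s \o l) => //; exists Ul; split => //.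
- by move=> t; rewrite inE => Ut; exact: cs.
- exact: segment_C1.
Qed.

Lemma segment_derivable t : Ul t -> derivable (psi \o (s \o l)) t 1.
Proof.
move=> Ut; have [c Ac ct] := chart_at hA (s (l t)).
have H : Ck_on 1 (Ul `&` (s \o l) @^-1` cdom c)
    ((psi \o cinv c) \o (cmap c \o (s \o l))).
  apply: (Ck1_comp (open_segment_chart (c := c)) (segment_C1 Ac)
    (psi_Ck hpsi 1 Ac)) => r [_ rc].
  by exists (s (l r)).
apply/derivable1_diffP.
apply: (near_eq_differentiable (g := (psi \o cinv c) \o (cmap c \o (s \o l)))).
  have : nbhs t (Ul `&` (s \o l) @^-1` cdom c).
    by apply: open_nbhs_nbhs; split => //; exact: open_segment_chart.
  apply: filterS => r [_ rc] /=; rewrite cmapK// inE//.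
by apply: H.1; rewrite inE.
Qed.

(** As [s] is a section, the space part of the lifted segment is [l + b], whatever its time
    coordinate does. *)
Lemma segment_velocity t i : Ul t ->
  ('D_1 (psi \o (s \o l)) t) 0 (lift 0 i) = be * v 0 i.
Proof.
move=> Ut; rewrite -derive_coord; last exact: segment_derivable.
have [_ /(_ t) dl] := Ck1_line v al be.
have dl' := is_derive_add (is_derive_coord 0 i dl) (is_derive_cst (b 0 i) t 1).
rewrite (near_eq_derive (g := fun r => l r 0 i + b 0 i)).
  by case: dl' => _ ->; rewrite mxE addr0.
have [_ Xs] := sU Ut.
have cl : {for t, continuous l}.
  apply: differentiable_continuous.
  by apply: (Ck1_line v al be).1.1; rewrite inE.
have : \forall r \near t, X (s (l r)) = l r by exact: cl _ Xs.
apply: filterS => r <-; rewrite /space_part.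
by rewrite mxE mul_space_mx mxE subrK.
Qed.

Definition segment_speed : R := Num.sqrt (2 * a * tmax * \sum_i v 0 i ^+ 2).

(** The time part of the velocity only shortens the curve, and the warping factor [2 a t] is at most
    [2 a tmax]. *)
Lemma segment_length_le :
  (curve_length G psi (s \o l) <= (`|be| * segment_speed)%:E)%E.
Proof.
apply: integral_unit_interval_le => [|t t01]; first by rewrite mulr_ge0// sqrtr_ge0.
have Ut : Ul t by exact: lU.
rewrite sqrtr_ge0/= /segment_speed -(sqrtr_sqr be) -sqrtrM ?sqr_ge0//.
have psi0 : 0 < psi ((s \o l) t) 0 0 by have [h _ _] := hpsi; exact: h.
rewrite ler_wsqrtr// radiation_innerE//.
have -> : sdot ('D_1 (psi \o (s \o l)) t) ('D_1 (psi \o (s \o l)) t) =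
    be ^+ 2 * \sum_i v 0 i ^+ 2.
  rewrite /sdot mulr_sumr; apply: eq_bigr => i _.
  by rewrite segment_velocity//; ring.
have S0 : 0 <= \sum_i v 0 i ^+ 2 by apply: sumr_ge0 => i _; exact: sqr_ge0.
apply: (@le_trans _ _ (2 * a * psi ((s \o l) t) 0 0 * (be ^+ 2 * \sum_i v 0 i ^+ 2))).
  by rewrite gerDr oppr_le0 -expr2 sqr_ge0.
rewrite [leRHS]mulrCA ler_wpM2r ?(mulr_ge0 (sqr_ge0 be) S0)//.
by rewrite ler_wpM2l ?htmax// mulr_ge0// ltW.
Qed.

End Segment.

Hypothesis hcomplete : complete_hypersurface A G psi.

Lemma radial_limit (p0 : M) D s v : starlike_section X p0 D s ->
  (forall t, 0 <= t < 1 -> D (t *: v)) ->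
  exists p : M, s ((1 - n.+1%:R^-1) *: v) @[n --> \oo] --> p.
Proof.
move=> S Dv; apply: hcomplete => e e0.
pose K := segment_speed v.
have K0 : 0 <= K by exact: sqrtr_ge0.
pose tn (n : nat) : R := 1 - n.+1%:R^-1.
have tn01 n : 0 <= tn n < 1.
  by rewrite subr_ge0 invf_le1// ler1n ltrBlDr ltrDl invr_gt0 ltr0n.
(* [K + 1] instead of [K] allows for [K = 0]. *)
have [N Nlt] : exists N : nat, N.+1%:R^-1 < e / (K + 1).
  have e1 : 0 < e / (K + 1) by rewrite divr_gt0// ltr_wpDl.
  have [N _ /(_ N (leqnn N)) NP] : \forall n \near \oo, n.+1%:R^-1 < e / (K + 1).
    have /cvgr_lt/(_ _ e1) := @cvg_harmonic R; exact.
  by exists N.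
exists N => i j Ni Nj.
pose al := tn i; pose be := tn j - tn i.
(* A convex combination of [tn i] and [tn j] stays below 1, the range in which the ray is known to
   lie in [D]. *)
have lD t : t \in `[0, 1]%R -> D ((al + t * be) *: v).
  rewrite in_itv/= => /andP[t0 t1]; apply: Dv.
  have /andP[i0 i1] := tn01 i; have /andP[j0 j1] := tn01 j.
  have -> : al + t * be = (1 - t) * tn i + t * tn j by rewrite /al /be; ring.
  apply/andP; split; first by apply: addr_ge0; apply: mulr_ge0 => //; rewrite subr_ge0.
  have [->|tn0] := eqVneq t 0; first by rewrite subr0 mul1r mul0r addr0.
  have tgt0 : 0 < t by rewrite lt_neqAle eq_sym tn0.
  have h1 : (1 - t) * tn i <= 1 - t by rewrite ler_piMr ?subr_ge0// ltW.
  have h2 : t * tn j < t by rewrite gtr_pMr.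
  by lra.
have [oD _ _ _ _] := S.
have sD y : D y -> section_near X s y by exact: starlike_section_near S.
have pw := segment_piecewise_C1 oD sD lD.
have len := segment_length_le oD sD lD.
have be_le : `|be| < e / (K + 1).
  have inv_le n : (N <= n)%N -> 0 < (n.+1%:R : R)^-1 <= N.+1%:R^-1.
    by move=> Nn; rewrite invr_gt0 ltr0n/= lef_pV2 ?posrE ?ltr0n// ler_nat ltnS.
  have /andP[i0 i1] := inv_le _ Ni; have /andP[j0 j1] := inv_le _ Nj.
  rewrite /be /tn ltr_norml; move: i0 i1 j0 j1 Nlt.
  move: (_^-1) (_^-1) (_^-1) (e / _) => x y z w *; apply/andP; split; lra.
apply: (@le_lt_trans _ _ (`|be| * K)%:E); last first.
  rewrite lte_fin; apply: (@le_lt_trans _ _ (`|be| * (K + 1))).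
    by rewrite ler_wpM2l// lerDl.
  by rewrite -ltr_pdivlMr// ltr_wpDl.
apply: le_trans len; apply: ereal_inf_lbound.
exists (s \o (fun t => (al + t * be) *: v)); split => //.
  by rewrite /= mul0r addr0.
by rewrite /= mul1r /al /be addrC subrK.
Qed.

End RadialLimits.

(** * The minimum of the barrier *)

Lemma exists_min_of_coercive (R : realType) m (F : 'rV[R]_m -> R)
    (b : 'rV[R]_m) (a c : R) :
  0 < a -> continuous F ->
  (forall y, a * `|y + b| ^+ 2 - c <= F y) -> exists y, forall z, F y <= F z.
Proof.
move=> a0 cF Fge.
pose k := (F 0 + c) / a.
(* The three terms put 0 in [B], ensure [r <= r ^+ 2], and give [a * r - c >= F 0]; so outside [B]
   the lower bound is at least [F 0]. *)
pose r := `|b| + 1 + `|k|.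
have r1 : 1 <= r by rewrite /r -addrA addrCA lerDl addr_ge0.
pose B := [set y : 'rV[R]_m | `|y + b| <= r].
have B0 : B 0 by rewrite /B/= add0r /r -addrA lerDl addr_ge0.
have Bc : compact B.
  apply: bounded_closed_compact.
    exists (r + `|b|); split; first exact: num_real.
    move=> M Mr y By; apply: le_trans (ltW Mr).
    by rewrite -[y](addrK b) (le_trans (ler_normB _ _))// lerD2r.
  rewrite (_ : B = closed_ball_ Num.norm (- b) r); first exact: closed_closed_ball_.
  have e y : `|- b - y| = `|y + b| by rewrite -opprD normrN addrC.
  by apply/seteqP; split=> y; rewrite /B /closed_ball_ /= e.
have [y yB ymin] : exists2 y, y \in B & forall z, z \in B -> F y <= F z.
  by apply: EVT_min_rV => //; [exists 0|exact: continuous_subspaceT].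
exists y => z; have [zB|zB] := pselect (B z); first by apply: ymin; rewrite inE.
apply: (@le_trans _ _ (F 0)); first by apply: ymin; rewrite inE.
apply: le_trans (Fge z); rewrite lerBrDr -ler_pdivrMl// mulrC -/k.
have rz : r < `|z + b| by rewrite ltNge; apply/negP.
rewrite (le_trans (ler_norm k))// (@le_trans _ _ r)//.
  by rewrite /r lerDr addr_ge0.
rewrite (le_trans (ltW rz))// expr2 ler_peMr//.
by rewrite (le_trans r1)// ltW.
Qed.

Lemma norm_sqr_le_sum (R : realType) m (u : 'rV[R]_m) :
  `|u| ^+ 2 <= \sum_i u 0 i ^+ 2.
Proof.
have S0 : 0 <= \sum_i u 0 i ^+ 2 by apply: sumr_ge0 => i _; exact: sqr_ge0.
rewrite -[leRHS]sqr_sqrtr// ler_sqr ?nnegrE ?sqrtr_ge0//.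
apply: norm_le_coord => [|i j]; first exact: sqrtr_ge0.
rewrite -(sqrtr_sqr (u i j)) ler_wsqrtr// ord1 (bigD1 j)//= lerDl.
by apply: sumr_ge0 => k _; exact: sqr_ge0.
Qed.

Theorem corollary17 (R : realType) (m : nat) (hm : (2 <= m)%N)
    (a : R) (ha : 0 < a)
    (M : topologicalType) (A : set (chart R m M)) (hM : smooth_manifold A) :
  let G : metric R m.+1 := @rw_metric R m (radiation_warping a) in
  ~ exists (psi N : M -> 'rV[R]_m.+1) (H : R),
      [/\ spacelike_hypersurface A G psi,
          complete_hypersurface A G psi,
          future_unit_normal A G psi N,
          constant_mean_curvature A G psi N H /\ H <= 0
        & bounded_away_from_future_infinity psi].
Proof.
move=> G [psi [N [H [hpsi hcomp [NC NN NT Nfut] [hH H0] hbd]]]].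
have [[p0 _] hT2 _ hA] := hM.
have [psi0 [_ psirf] psir] := hpsi.
have psipos p : 0 < psi p 0 0 by exact: psi0.
have [tmax htmax] : exists tmax, forall p, psi p 0 0 <= tmax.
  move: hbd; rewrite /bounded_away_from_future_infinity.
  set E := (X in ereal_sup X) => hE.
  have ub p : ((psi p 0 0)%:E <= ereal_sup E)%E by apply: ereal_sup_ubound; exists p.
  exists (fine (ereal_sup E)) => p; rewrite -lee_fin fineK//.
  by rewrite fin_numElt hE (lt_le_trans _ (ub p0))// ltNyr.
have tmax0 : 0 < tmax by exact: lt_le_trans (psipos p0) (htmax p0).
pose b0 : 'rV[R]_m := psi p0 *m space_mx R m.
pose X := space_part psi b0.
have X0 : X p0 = 0 by rewrite /X /space_part subrr.
have cX : continuous X by exact: space_part_continuous hA hpsi b0.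
have locinvC := space_part_local_inverse ha hA hpsi b0.
have locinv p : exists d i, local_inverse X p d i.
  by have [d [i [LI _]]] := locinvC p; exists d, i.
have [s [cs Xs sp0]] : exists s, [/\ forall y, {for y, continuous s},
    forall y, X (s y) = y & s 0 = p0].
  apply: exists_global_section => //.
  move=> D s v S Dv.
  exact: (radial_limit ha hA hpsi htmax hcomp S Dv).
(* As [t <= tmax], this makes [bb * (a / Num.sqrt (2 * a * t))] at least 3, hence above the
   threshold 2, at every point of the hypersurface. *)
pose bb := 3 * Num.sqrt (2 * a * tmax) / a.
have bb0 : 0 <= bb by rewrite divr_ge0 ?mulr_ge0 ?sqrtr_ge0// ltW.
pose F y := radiation_barrier a bb (psi (s y)).
have cpsi : continuous psi by exact: psi_continuous hA hpsi.
have cF : continuous F.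
  have cs' y : {for y, continuous (psi \o s)}.
    by apply: continuous_comp; [exact: cs|exact: cpsi].
  have cb (u : 'rV[R]_m.+1) : {for u, continuous (radiation_barrier a bb)}.
    have co j : {for u, continuous (fun v : 'rV[R]_m.+1 => v 0 j)}.
      exact: differentiable_continuous (differentiable_coord u 0 j).
    have c1 : {for u, continuous (fun v : 'rV[R]_m.+1 =>
        \sum_i v 0 (lift 0 i) ^+ 2)}.
      apply: continuous_sumE => i.
      exact: (continuous_comp (co (lift 0 i)) (@exprn_continuous _ 2 _)).
    have c2 : {for u, continuous (fun v : 'rV[R]_m.+1 => 2 * a * v 0 0)}.
      exact: cvgM (cvg_cst _) (co 0).
    have c3 := continuous_comp c2 (@sqrt_continuous R _).
    exact: cvgB (cvgD (cvgM (cvg_cst _) c1) (cvgM (cvg_cst _) c3)) (co 0).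
  by move=> y; exact: (continuous_comp (cs' y) (cb _)).
(* The square root term is non-negative, the time is at most [tmax], and the space part of
   [psi (s y)] is [y + b0]. *)
have Fge y : a * 2^-1 * `|y + b0| ^+ 2 - tmax <= F y.
  rewrite /F /radiation_barrier lerB ?htmax//.
  rewrite -[leLHS]addr0 lerD//; last by rewrite mulr_ge0// sqrtr_ge0.
  rewrite ler_wpM2l ?mulr_ge0 ?(ltW ha)// (le_trans (norm_sqr_le_sum _))//.
  rewrite le_eqVlt; apply/orP; left; apply/eqP; apply: eq_bigr => i _.
  by rewrite -mul_space_mx -[in LHS](Xs y) /X /space_part subrK.
have [y1 y1min] : exists y, forall z, F y <= F z.
  by apply: exists_min_of_coercive cF Fge; rewrite mulr_gt0.
pose p1 := s y1.
have Xp1 : X p1 = y1 by exact: Xs.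
(* Near [p1] the section undoes the projection, [s (X q) = i (X q) = q], so minimality over R^m
   passes to the hypersurface. *)
have p1min : \forall q \near p1,
    radiation_barrier a bb (psi p1) <= radiation_barrier a bb (psi q).
  have [d [i LI]] := locinv p1; have [d0 ib ip iX] := LI.
  have y1b : ball (X p1) d y1 by rewrite Xp1; exact: ballxx.
  have sn : section_near X s y1 by split; [exact: cs|exact: (@filterE _ (nbhs y1) _ _ Xs)].
  have si : \forall z \near y1, s z = i z.
    apply: sections_agree_near sn (local_inverse_near LI y1b) _ => //.
    by rewrite -[in RHS]Xp1 ip.
  have siX : \forall q \near p1, s (X q) = i (X q).
    have siX1 : nbhs (X p1) [set z | s z = i z] by rewrite Xp1.
    exact: (@cX p1 _ siX1).
  apply: filterS2 iX siX => q iq sq.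
  by have := y1min (X q); rewrite /F sq iq.
have [c Ac cp] := chart_at hA p1.
pose x := cmap c p1.
have xU : cimg c x by exists p1.
have cx : cinv c x = p1 by apply: cmapK; rewrite inE.
have fmin : \forall z \near x, radiation_barrier a bb ((psi \o cinv c) x) <=
    radiation_barrier a bb ((psi \o cinv c) z).
  have ci : {for x, continuous (cinv c)} by apply: cinv_continuous; rewrite inE.
  rewrite /= cx; apply: (ci [set q | radiation_barrier a bb (psi p1) <=
    radiation_barrier a bb (psi q)]).
  by rewrite cx.
have trS : \tr (- cov_along G (psi \o cinv c) (N \o cinv c) x *m
    pinvmx ('J (psi \o cinv c) x)) < 0.
  apply: (@radiation_no_local_min R m a bb (cimg c)) fmin => //.
  - exact: ltn_trans hm.
  - exact: cimg_open.
  - exact: (psi_Ck hpsi 2 Ac).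
  - exact: (NC c Ac 1%N).
  - by move=> z _; exact: psipos.
  - move=> v v0; have := psir c Ac x xU v v0; rewrite induced_inner; exact.
  - exact: psirf.
  - by move=> z _; exact: NN.
  - by move=> z v zU; exact: NT.
  - exact: Nfut.
  - rewrite /= cx; have p10 := psipos p1.
    have q0 : 0 < Num.sqrt (2 * a * psi p1 0 0) by rewrite sqrtr_gt0 !mulr_gt0.
    have -> : bb * (a / Num.sqrt (2 * a * psi p1 0 0)) =
        3 * (Num.sqrt (2 * a * tmax) / Num.sqrt (2 * a * psi p1 0 0)).
      by rewrite /bb; field; rewrite !gt_eqF.
    have : 1 <= Num.sqrt (2 * a * tmax) / Num.sqrt (2 * a * psi p1 0 0).
      by rewrite ler_pdivlMr// mul1r ler_wsqrtr// ler_wpM2l ?htmax// mulr_ge0// ltW.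
    by move: (_ / _) => r r1; lra.
(* The mean curvature is minus the trace divided by [m], so [trS] makes it positive at [p1]. *)
have := hH c x Ac xU; rewrite /mean_curvature /shape_operator => HE.
move: H0; rewrite -HE oppr_le0 pmulr_rge0 ?invr_gt0 ?ltr0n ?(ltn_trans _ hm)//.
by rewrite leNgt trS.
Qed.
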